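(* Let $\mathcal I$ be a left-invariant Steinhaus $\sigma$-ideal with a functionally coanalytic base on a $K$-analytic topological group $X$ such that $\mathcal{B}o\subseteq\mathcal{B}a^\pm\mathcal I$. For a homomorphism $h:X\to Y$ to a topological group $Y$ the following are equivalent: (1) $h$ is continuous; (2) $h$ is $\mathcal{B}o^\pm\mathcal I$-measurable; (3) $h$ is $\mathcal{B}a^\pm\mathcal I$-measurable; (4) $h$ is $\mathcal A^\curlyvee\mathcal I$-semimeasurable.
   Context: $\mathcal{B}o$ and $\mathcal{B}a$ are the $\sigma$-algebras of Borel and of functionally Borel subsets of $X$ (a set is functionally Borel, resp. functionally analytic, if it is $f^{-1}[B]$ for a continuous $f:X\to\mathbb R^\omega$ and Borel, resp. analytic, $B\subseteq\mathbb R^\omega$; functionally coanalytic if its complement is functionally analytic). A Tychonoff space is $K$-analytic if it is a continuous image of a Lindelöf Čech-complete space. A $\sigma$-ideal on $X$ is closed under countable unions and subsets with $X=\bigcup\mathcal I$, $X\notin\mathcal I$; left-invariant if $xI\in\mathcal I$ for $I\in\mathcal I$, $x\in X$; has a functionally coanalytic base if each member lies in a functionally coanalytic member; is Steinhaus if for some $n\in\mathbb N$, for every $K$-analytic $A\notin\mathcal I$ the set $(AA^{-1})^{\cdot n}$ is a neighborhood of the identity. $\mathcal A^\pm\mathcal I$ is the $\sigma$-algebra generated by $\mathcal A\cup\mathcal I$; a function is $\mathcal S$-measurable if preimages of open sets lie in $\mathcal S$. A set $M$ is $\mathcal A^\curlyvee\mathcal I$-semimeasurable if for every $K$-analytic $A$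 with $A\cap M\notin\mathcal I$ there is a $K$-analytic $B\subseteq A\cap M$ with $B\notin\mathcal I$; a function is $\mathcal A^\curlyvee\mathcal I$-semimeasurable if preimages of open sets are. *)

(* Defs.v *)
From HB Require Import structures.
From mathcomp Require Import all_boot all_algebra.
From mathcomp Require Import all_classical all_reals all_analysis.
From mathcomp Require Import Rstruct Rstruct_topology borel_hierarchy.

Set Implicit Arguments.
Unset Strict Implicit.
Unset Printing Implicit Defensive.

Local Open Scope classical_set_scope.

Definition Romega := {ptws nat -> Rdefinitions.R}.
Definition Baire := {ptws nat -> nat}.

Definition Borel (T : topologicalType) : set (set T) := <<s @open T >>.

Definition analytic_Romega (B : set Romega) : Prop :=
  B = set0 \/ exists f : Baire -> Romega, continuous f /\ range f = B.

Section TopDefs.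
Context (X : topologicalType).

Definition fBorel (A : set X) : Prop :=
  exists (f : X -> Romega) (B : set Romega),
    continuous f /\ Borel B /\ A = f @^-1` B.

Definition fanalytic (A : set X) : Prop :=
  exists (f : X -> Romega) (B : set Romega),
    continuous f /\ analytic_Romega B /\ A = f @^-1` B.

Definition fcoanalytic (A : set X) : Prop := fanalytic (~` A).

Definition Bo : set (set X) := @Borel X.
Definition Ba : set (set X) := fBorel.

Definition gen_pm (A I : set (set X)) : set (set X) := <<s A `|` I >>.

Definition tychonoff : Prop :=
  hausdorff_space X /\
  forall (B : set X) (a : X), closed B -> ~ B a ->
    exists f : X -> Rdefinitions.R, continuous f /\ f a = 0%R /\
      (forall b, B b -> f b = 1%R).

Definition lindelof : Prop :=
  forall C : set (set X), (forall U, C U -> open U) ->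
    \bigcup_(U in C) U = setT ->
    exists D : set (set X), D `<=` C /\ countable D /\ \bigcup_(U in D) U = setT.

Definition embedding (K : topologicalType) (e : X -> K) : Prop :=
  continuous e /\ injective e /\
  forall U : set X, open U -> exists V : set K, open V /\ e @` U = V `&` range e.

Definition cech_complete : Prop :=
  tychonoff /\
  exists (K : topologicalType) (e : X -> K),
    compact [set: K] /\ hausdorff_space K /\ embedding e /\ Gdelta (range e).

End TopDefs.

Section KAnalytic.
Context (X : topologicalType).

Definition KAnalytic_set (A : set X) : Prop :=
  exists (Z : topologicalType) (f : Z -> X),
    lindelof Z /\ cech_complete Z /\ continuous f /\ range f = A.

Definition KAnalytic_space : Prop := tychonoff X /\ KAnalytic_set setT.

End KAnalytic.

Record topological_group (X : topologicalType) (mul : X -> X -> X)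
    (inv : X -> X) (one : X) : Prop := TopGroup {
  tg_mulA : forall x y z, mul x (mul y z) = mul (mul x y) z;
  tg_mul1x : forall x, mul one x = x;
  tg_mulx1 : forall x, mul x one = x;
  tg_mulVx : forall x, mul (inv x) x = one;
  tg_mulxV : forall x, mul x (inv x) = one;
  tg_mul_cont : continuous (fun p : X * X => mul p.1 p.2);
  tg_inv_cont : continuous inv
}.

Section Ideals.
Context (X : topologicalType) (mul : X -> X -> X) (inv : X -> X) (one : X).

Definition sigma_ideal (I : set (set X)) : Prop :=
  (forall F : (set X)^nat, (forall n, I (F n)) -> I (\bigcup_n F n)) /\
  (forall A B : set X, B `<=` A -> I A -> I B) /\
  \bigcup_(A in I) A = setT /\
  ~ I setT.

Definition left_invariant (I : set (set X)) : Prop :=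
  forall (x : X) (A : set X), I A -> I [set mul x a | a in A].

Definition fcoanalytic_base (I : set (set X)) : Prop :=
  forall A, I A -> exists C, I C /\ A `<=` C /\ fcoanalytic C.

Definition setmul (S T : set X) : set X := [set mul s t | s in S & t in T].
Definition setdiff_inv (A : set X) : set X := setmul A [set inv a | a in A].

(* S^{.n} for n >= 1: setpow S 1 = S, setpow S n.+1 = setpow S n * S *)
Fixpoint setpow (S : set X) (n : nat) : set X :=
  match n with
  | 0 => S
  | 1 => S
  | n'.+1 => setmul (setpow S n') S
  end.

Definition steinhaus (I : set (set X)) : Prop :=
  exists n : nat, (0 < n)%N /\
    forall A : set X, KAnalytic_set A -> ~ I A ->
      nbhs one (setpow (setdiff_inv A) n).

Definition semimeasurable_set (I : set (set X)) (M : set X) : Prop :=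
  forall A : set X, KAnalytic_set A -> ~ I (A `&` M) ->
    exists B : set X, KAnalytic_set B /\ B `<=` A `&` M /\ ~ I B.

End Ideals.

Definition measurable_wrt (X Y : topologicalType) (S : set (set X)) (h : X -> Y)
  : Prop := forall U : set Y, open U -> S (h @^-1` U).

Definition semimeasurable_fun (X Y : topologicalType) (I : set (set X))
  (h : X -> Y) : Prop :=
  forall U : set Y, open U -> semimeasurable_set I (h @^-1` U).

Arguments Bo X : clear implicits.
Arguments Ba X : clear implicits.

(* Main.v *)
Require Import Defs.
From mathcomp Require Import all_boot all_order all_algebra.
From mathcomp Require Import all_classical all_reals all_analysis.
From mathcomp Require Import Rstruct Rstruct_topology borel_hierarchy wochoice.
From Stdlib Require Import Inverse_Image.
Import Order.TTheory GRing.Theory Num.Theory.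
Import numFieldNormedType.Exports.

Set Implicit Arguments.
Unset Strict Implicit.
Unset Printing Implicit Defensive.

Local Open Scope classical_set_scope.

(** Only "semimeasurable implies continuous" is deep. By the Steinhaus property
it suffices that [h @^-1` W] is not in [I] for every neighborhood [W] of the
identity. If some [h @^-1` W] is in [I], cover [X] by the left translates of a
suitable [Vs] inside it and refine this cover, as in Stone's theorem on the
paracompactness of metric spaces, to countably many disjoint families
[(E_x)_(x in X)], each with all its partial unions preimages of open sets.
[Vs] lies in a set [C] of [I] defined by a continuous map to [R^omega], and as
[X] is Lindelöf, this map is insensitive to left multiplication by elements
[x^-1 y], for [x] and [y] with the same code in the Cantor space. The [E_x] with
a given code lie in one translate of [C], so each family, grouped by codes, is a
family of members of [I] indexed by the Cantor space, all of whose partial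
unions are semimeasurable. The union of such a family is in [I]: otherwise
split the index set by a Bernstein set; one of the two halves contains a
K-analytic set outside [I], in which a fusion argument finds points whose
indices form a perfect set. Closure properties of K-analytic sets are read off
their description as the results of the Souslin operation on closed sets. *)

(** * Subspaces of compact spaces *)

Lemma lindelof_seq (X : topologicalType) (x0 : X) (F : X -> set X) :
  lindelof X -> (forall x, nbhs x (F x)) ->
  exists s : nat -> X, forall y, exists n, F (s n) y.
Proof.
move=> LX nF; have [||D [DC [cD Dcov]]] := LX [set (F x)° | x in setT].
- by move=> _ [x _ <-]; exact: open_interior.
- apply/seteqP; split=> // x _; exists (F x)°; first by exists x.
  exact: nF.
move: cD; rewrite /countable => /pfcard_geP[D0|[g]].
  by have : [set: X] x0 by []; rewrite -Dcov D0 bigcup_set0.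
have /choice[s sP] n : exists x, D (g n) -> g n = (F x)°.
  have [/DC[x _ e]|nD] := pselect (D (g n)); first by exists x => _; rewrite e.
  by exists x0.
exists s => y; have : [set: X] y by [].
rewrite -Dcov => -[U DU Uy]; have [n _ gn] := @surj _ _ _ _ g _ DU.
exists n; apply: interior_subset; rewrite -sP gn //.
Qed.

Lemma compact_ultra_cvg (K : topologicalType) (Z : Type) (e : Z -> K)
  (H : set_system Z) : compact [set: K] -> UltraFilter H ->
  exists p : K, forall U, nbhs p U -> H (e @^-1` U).
Proof.
move=> cK UH; have PF : ProperFilter (e @ H) by apply: fmap_proper_filter.
have [|p [_ clp]] := cK (e @ H) PF; first exact: filterT.
exists p => U nU; have [//|HC] := in_ultra_setVsetC (e @^-1` U) UH.
by have [x [nx Ux]] := clp (~` U) U HC nU.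
Qed.

Section SetType.
Context (K : topologicalType) (T : set K).

Lemma open_set_typeP (U : set T) :
  open U <-> exists2 W : set K, open W & U = set_val @^-1` W.
Proof. by split=> [[W oW <-]|[W oW ->]]; exists W. Qed.

Lemma set_type_nbhs (t : T) (W : set K) :
  nbhs (set_val t) W -> nbhs t (set_val @^-1` W).
Proof. exact: initial_continuous. Qed.

Lemma set_type_hausdorff : hausdorff_space K -> hausdorff_space T.
Proof.
move=> hK p q pq; apply: val_inj; apply: hK => A B nA nB.
have [t [At Bt]] := pq _ _ (set_type_nbhs nA) (set_type_nbhs nB).
by exists (set_val t).
Qed.

Lemma set_type_tychonoff :
  compact [set: K] -> hausdorff_space K -> Defs.tychonoff T.
Proof.
move=> cK hK; split; first exact: set_type_hausdorff.
move=> B a cB Ba; have /open_set_typeP[W oW BW] : open (~` B) by rewrite openC.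
have Wa : W (set_val a) by rewrite -[W _]/((set_val @^-1` W) a) -BW.
have sep : uniform_separator [set set_val a] (~` W).
  apply: (@normal_completely_regular Rdefinitions.R) => //.
  - exact: compact_normal.
  - exact: hausdorff_accessible.
  - by rewrite closedC.
pose g := @Urysohn K Rdefinitions.R [set set_val a] (~` W).
exists (g \o set_val); split; [|split].
- move=> x; apply: continuous_comp; first exact: initial_continuous.
  exact: Urysohn_continuous.
- by apply: (Urysohn_sub0 sep); exists (set_val a).
- move=> b Bb; apply: (Urysohn_sub1 sep); exists (set_val b) => // Wb.
  by have : (~` B) b by rewrite BW.
Qed.

Lemma set_type_compact : compact [set: K] -> closed T -> compact [set: T].
Proof.
move=> cK cT G PG _; have PF : ProperFilter (set_val @ G) by apply:
  fmap_proper_filter.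
have GT : (set_val @ G) T.
  by apply: (@filterS _ G _ setT); [move=> t _; exact: set_valP|exact: filterT].
have [p [Tp clp]] := subclosed_compact cT cK (@subsetT _ T) PF GT.
exists (exist _ p (mem_set Tp)); split=> // A B GA [_ [[W oW <-] Wp WB]].
have GA' : G (set_val @^-1` [set set_val t | t in A]).
  by apply: (filterS _ GA) => t At; exists t.
have [_ [[t At <-] Wt]] := clp _ W GA' (open_nbhs_nbhs (conj oW Wp)).
by exists t; split=> //; exact: WB.
Qed.

End SetType.

Section CompactSubset.
Context (K : topologicalType) (T H : set K).
Hypothesis cK : compact [set: K].
Hypothesis hK : hausdorff_space K.
Hypothesis cH : closed H.

(** If countably many members of [C] never cover [T], choosing one piece [F n k] after another gives
    decreasing closed sets [S n] with the same defect. The filter [G] contains the traces of the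
    [S n] and the complements of the members of [C], so compactness yields a point of [T] outside
    all members of [C]. *)
Lemma lindelof_set_type (F : nat -> nat -> set K) :
  (forall n k, closed (F n k)) -> T = H `&` \bigcap_n \bigcup_k F n k ->
  lindelof T.
Proof.
move=> cF TE C oC covC.
have TP x : T x -> H x /\ forall n, exists k, F n k x.
  by rewrite TE => -[Hx Fx]; split=> // n; have [k _ ?] := Fx n I; exists k.
pose small (A : set T) := exists D : set (set T),
  [/\ D `<=` C, countable D & A `<=` \bigcup_(U in D) U].
have smallS (A B : set T) : A `<=` B -> small B -> small A.
  by move=> AB [D [DC cD BD]]; exists D; split=> //; exact: subset_trans BD.
have small_cup (A : nat -> set T) : (forall n, small (A n)) -> small (\bigcup_n
  A n).
  move=> /choice[D DP]; exists (\bigcup_n D n); split.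
  - by move=> U [n _]; have [+ _ _] := DP n; exact.
  - by apply: bigcup_countable => // n _; have [] := DP n.
  - move=> t [n _ Ant]; have [_ _ /(_ t Ant) [U DU Ut]] := DP n.
    by exists U => //; exists n.
have smallU (A B : set T) : small A -> small B -> small (A `|` B).
  move=> sA sB; apply: (@smallS _ (\bigcup_n (if n is 0%N then A else B))).
    by move=> t [?|?]; [exists 0%N|exists 1%N].
  by apply: small_cup => -[].
suff [D [DC cD covD]] : small setT.
  by exists D; split=> //; split=> //; apply/seteqP.
apply: contrapT => nT.
have /choice[kf kfP] (p : nat * set K) : exists k, ~ small (set_val @^-1` p.2)
  ->
    ~ small (set_val @^-1` (p.2 `&` F p.1 k)).
  case: p => n S /=; apply: contrapT => nk.
  have nS : ~ small (set_val @^-1` S) by move=> sS; apply: nk; exists 0%N.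
  apply: nS; apply: (@smallS _ (\bigcup_k set_val @^-1` (S `&` F n k))).
    by move=> t St; have [_ /(_ n)[k Fk]] := TP _ (set_valP t); exists k.
  apply: small_cup => k; apply: contrapT => ns; apply: nk; exists k => _;
    exact: ns.
pose S := fix S n := if n is n'.+1 then S n' `&` F n' (kf (n', S n')) else H.
have nS n : ~ small (set_val @^-1` S n).
  elim: n => [|n IH]; last exact: (kfP (n, S n)).
  apply: contra_not nT; apply: smallS => t _ /=.
  by have [] := TP _ (set_valP t).
have cS n : closed (S n) by elim: n => // n IH; exact: closedI.
have decS n m : (n <= m)%N -> S m `<=` S n.
  elim: m => [|m IH]; first by rewrite leqn0 => /eqP ->.
  rewrite leq_eqVlt => /orP[/eqP -> //|]; rewrite ltnS => /IH;
    apply: subset_trans.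
  by move=> x [].
pose G : set_system T := [set A | exists n, small (set_val @^-1` S n `\` A)].
have PG : ProperFilter G.
  apply: Build_ProperFilter_ex.
    move=> A [n sA]; apply: contrapT => A0; apply: (nS n); apply: smallS sA.
    by move=> t St; split=> // At; apply: A0; exists t.
  split.
  - exists 0%N; rewrite setDT; exists set0; split=> //.
  - move=> A B [n sA] [m sB]; exists (maxn n m);
    apply: smallS (smallU _ _ sA sB).
    move=> t [St nAB]; have [At|nAt] := pselect (A t); [right|left].
      split; first by apply: decS St; exact: leq_maxr.
      by move=> Bt; apply: nAB.
    by split=> //; apply: decS St; exact: leq_maxl.
  - move=> A B AB [n sA]; exists n; apply: smallS sA => t [St nB]; split=> //.
    by move=> /AB.
have PF : ProperFilter (set_val @ G) by apply: fmap_proper_filter.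
have [|p [_ clp]] := cK PF; first exact: filterT.
have Sp n : S n p.
  have -> : S n = closure (S n) by apply/closure_id.
  move=> U nU; apply: clp nU; exists n.
  by exists set0; split=> // t [].
have Tp : T p.
  rewrite TE; split; first exact: (Sp 0%N).
  by move=> n _; exists (kf (n, S n)) => //; have [] := Sp n.+1.
pose t : T := exist _ p (mem_set Tp).
have : [set: T] t by []; rewrite -covC => -[U CU Ut].
have /open_set_typeP[W oW UW] := oC _ CU.
have Wp : W p by rewrite -[W p]/((set_val @^-1` W) t) -UW.
have GW : (set_val @ G) (~` W).
  exists 0%N; exists [set U]; split=> [V ->|//|s [_ /contrapT Ws]] //.
  by exists U => //; rewrite UW.
by have [q [nW /nW]] := clp _ W GW (open_nbhs_nbhs (conj oW Wp)).
Qed.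

Lemma cech_complete_set_type (O : nat -> set K) :
  (forall n, open (O n)) -> T = H `&` \bigcap_n O n -> cech_complete T.
Proof.
move=> oO TE; split; first exact: set_type_tychonoff.
have TP x : T x -> H x /\ forall n, O n x.
  by rewrite TE => -[Hx Ox]; split=> // n; exact: Ox.
have TH (t : T) : set_val t \in H.
  by apply/mem_set; have [] := TP _ (set_valP t).
pose e (t : T) : H := exist _ (set_val t) (TH t).
have eE t : set_val (e t) = set_val t by [].
exists H, e; split; first exact: set_type_compact.
split; first exact: set_type_hausdorff.
split; [split; [|split]|].
- apply/continuousP => _ [W oW <-]; exists W => //.
- by move=> s t /(congr1 set_val) /= st; exact: val_inj.
- move=> U /open_set_typeP[W oW ->]; exists (set_val @^-1` W); split;
  first by exists W.
  apply/seteqP; split=> [_ [t Wt <-]|x [Wx [t _ tx]]]; first by split=> //;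
    exists t.
  by exists t => //; rewrite /= -eE tx.
exists (fun n => set_val @^-1` O n); first by move=> n; exists (O n).
apply/seteqP; split=> [_ [t _ <-] n _|x xO] /=.
  by have [_] := TP _ (set_valP t); exact.
have Tx : T (set_val x) by rewrite TE; split; [exact: set_valP|move=> n _;
  exact: xO].
by exists (exist _ (set_val x) (mem_set Tx)) => //; exact: val_inj.
Qed.

End CompactSubset.

(** * Souslin sets and K-analytic sets *)

(** By regularity of [K] each [e z] has a neighborhood whose closure lies in [O n]; the Lindelöf
    property leaves countably many of these closures, the [F n k]. *)
Lemma cech_lindelof_compact (Z : topologicalType) :
  lindelof Z -> cech_complete Z ->
  exists (K : topologicalType) (e : Z -> K) (O : nat -> set K)
    (F : nat -> nat -> set K),
    [/\ compact [set: K] /\ hausdorff_space K, embedding e,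
      (forall n, open (O n)) /\ range e = \bigcap_n O n,
      forall n k, closed (F n k) /\ F n k `<=` O n &
      forall z n, exists k, F n k (e z)].
Proof.
move=> LZ [tZ [K [e [cK [hK [emb [ O oO eO]]]]]]].
exists K, e, O.
have [[z0 _]|Z0] := pselect (exists z : Z, True); last first.
  exists (fun _ _ => set0); split=> //; last by move=> z; exfalso; apply: Z0;
    exists z.
  by move=> n k; split; [exact: closed0|].
have /choice[B BP] (p : nat * Z) : exists B, nbhs (e p.2) B /\ closure B `<=` O
  p.1.
  have Oe : nbhs (e p.2) (O p.1).
    apply: open_nbhs_nbhs; split=> //.
    by have : range e (e p.2) by [exists p.2]; rewrite eO; exact.
  have [B nB cB] := @compact_regular K (e p.2) setT hK cK filterT _ Oe.
  by exists B.
have /choice[s sP] n : exists s : nat -> Z, forall z, exists k, B (n, s k) (e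
  z).
  have [|s sP] := @lindelof_seq Z z0 (fun z => e @^-1` B (n, z)) LZ;
    last by exists s.
  by move=> z; apply: emb.1; exact: (BP (n, z)).1.
exists (fun n k => closure (B (n, s n k))); split=> //.
- by move=> n k; split; [exact: closed_closure|exact: (BP (n, s n k)).2].
- by move=> z n; have [k Bk] := sP n z; exists k; exact: subset_closure.
Qed.

(** The second clause is upper semicontinuity in ultrafilter form: along a branch [s] the sets
    shrink to a compact set, every neighborhood of which contains one of them. *)
Definition scheme (X : topologicalType) (D : seq nat -> set X) :=
  (forall s, D s = \bigcup_k D (rcons s k)) /\
  (forall (G : set_system X) (s : nat -> nat), UltraFilter G ->
    (forall n, G (D (mkseq s n))) ->
    exists y, (G --> y) /\ forall n, D (mkseq s n) y).

(** [D s] is the image of the points [z] with [e z] in [F i (s i)] for [i] below the length of [s].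
    An ultrafilter along a branch lifts to [Z] and converges in [K]; the limit lies in the closed
    sets [F i (s i)], hence in every [O i], and so comes from [Z]. *)
Lemma KAnalytic_has_scheme (X : topologicalType) (A : set X) :
  KAnalytic_set A -> exists2 D, scheme D & D [::] = A.
Proof.
case=> Z [f [LZ [cZ [cf <-]]]].
have [K [e [ O [F [[cK hK] [ce [ie oe]] [oO eO] FP Fe]]]]] :=
  cech_lindelof_compact LZ cZ.
pose Zs s : set Z := [set z | forall i, (i < size s)%N -> F i (nth 0%N s i) (e
  z)].
have ZsS s z k : Zs s z -> F (size s) k (e z) -> Zs (rcons s k) z.
  move=> Zz Fz i; rewrite size_rcons ltnS leq_eqVlt nth_rcons.
  by case/orP => [/eqP ->|lt]; [rewrite ltnn eqxx|rewrite lt; exact: Zz].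
have ZsW s z k : Zs (rcons s k) z -> Zs s z.
  move=> Zz i lt; have := Zz i; rewrite size_rcons ltnS nth_rcons lt.
  by apply; exact: ltnW.
exists (fun s => f @` Zs s); last first.
  by apply/seteqP; split=> _ [z _ <-]; exists z.
split=> [s|G s UG GD].
  apply/seteqP; split=> [_ [z Zz <-]|_ [k _ [z Zz <-]]].
    by have [k Fk] := Fe z (size s); exists k => //; exists z => //; exact: ZsS.
  by exists z => //; exact: ZsW Zz.
have Zs_decr n m : (n <= m)%N -> Zs (mkseq s m) `<=` Zs (mkseq s n).
  move=> nm z Zz i; rewrite size_mkseq => lt; have := Zz i.
  rewrite size_mkseq !nth_mkseq //; last exact: leq_trans nm.
  by apply; exact: leq_trans nm.
pose H0 := filter_from [set p : set X * nat | G p.1]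
  (fun p => f @^-1` p.1 `&` Zs (mkseq s p.2)).
have PH0 : ProperFilter H0.
  apply: filter_from_proper.
    apply: filter_from_filter; first by exists (setT, 0%N); exact: filterT.
    move=> [P n] [Q m] GP GQ; exists (P `&` Q, maxn n m); first exact: filterI.
    move=> z [[Pz Qz] Zz]; split; split=> //; apply: Zs_decr Zz.
      exact: leq_maxl.
    exact: leq_maxr.
  move=> [P n] /= GP; have [x [Px [z Zz zx]]] := filter_ex (filterI GP (GD n)).
  by exists z; split=> //; rewrite /= zx.
have [H [UH H0H]] := ultraFilterLemma PH0.
have HZ n : H (Zs (mkseq s n)).
  by apply: H0H; exists (setT, n); [exact: filterT|move=> z []].
have HG P : G P -> H (f @^-1` P) by move=> GP; apply: H0H;
  exists (P, 0%N) => // z [].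
have [p pP] := compact_ultra_cvg e cK UH.
have Fp i : F i (s i) p.
  have -> : F i (s i) = closure (F i (s i)) by apply/closure_id;
    exact: (FP _ _).1.
  move=> U /pP HU; have [z [Uz Zz]] := filter_ex (filterI HU (HZ i.+1)).
  exists (e z); split=> //; have := Zz i; rewrite size_mkseq nth_mkseq //.
  by apply.
have [z _ ez] : range e p by rewrite eO => n _; exact: (FP _ _).2 (Fp n).
have Hz : H --> z.
  move=> U; rewrite nbhsE => -[U' [oU' U'z] U'U].
  have [V [oV eV]] := oe _ oU'.
  have Vp : V p.
    by have [] : (V `&` range e) p by rewrite -eV -ez; exists z.
  apply: filterS (pP V (open_nbhs_nbhs (conj oV Vp))) => x Vx.
  have [x' U'x' /ie xx'] : (e @` U') (e x) by rewrite eV; split=> //; exists x.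
  by apply: U'U; rewrite -xx'.
exists (f z); split.
  move=> N nN; have [//|GC] := in_ultra_setVsetC N UG.
  have Hf : H (f @^-1` N) by apply: Hz; exact: cf.
  by have [x [Nx nNx]] := filter_ex (filterI Hf (HG _ GC)).
by move=> n; exists z => // i; rewrite size_mkseq => lt;
  rewrite nth_mkseq // ez.
Qed.

Section Souslin.
Context (X : topologicalType).

Definition souslin (A : set X) := exists2 C : seq nat -> set X,
  (forall s, closed (C s)) & A = [set x | exists t, forall n, C (mkseq t n) x].

(** Condition [j] reads only the first [N j] terms of [t], so the closed set at a finite sequence
    [s] can impose all conditions that [s] already decides. *)
Lemma souslin_local (J : Type) (E : J -> (nat -> nat) -> set X) (N : J -> nat) :
  (forall j t, closed (E j t)) ->
  (forall j t t', (forall i, (i < N j)%N -> t i = t' i) -> E j t = E j t') ->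
  souslin [set x | exists t, forall j, E j t x].
Proof.
move=> cE lE.
exists (fun s => \bigcap_(j in [set j | (N j <= size s)%N]) E j (nth 0%N s)).
  by move=> s; apply: closed_bigI => j _.
apply/seteqP; split=> x [t tx]; exists t.
  move=> n j /=; rewrite size_mkseq => le; rewrite (lE j _ t) // => i lt.
  by rewrite nth_mkseq //; exact: leq_trans le.
move=> j; have := tx (N j) j; rewrite /= size_mkseq => /(_ (leqnn _)).
by rewrite (lE j _ t) // => i lt; rewrite nth_mkseq.
Qed.

Lemma souslin_closed (A : set X) : closed A -> souslin A.
Proof.
move=> cA; exists (fun=> A) => //.
by apply/seteqP; split=> x; [exists (fun=> 0%N)|case=> t /(_ 0%N)].
Qed.

Lemma souslin_bigcup (A : nat -> set X) :
  (forall n, souslin (A n)) -> souslin (\bigcup_n A n).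
Proof.
move=> sA; have /choice[C CP] n : exists C : seq nat -> set X,
    (forall s, closed (C s)) /\ A n = [set x | exists t, forall n, C (mkseq t
      n) x].
  by have [C] := sA n; exists C.
rewrite (_ : \bigcup_n _ = [set x | exists t, forall n,
    C (t 0%N) (mkseq (t \o succn) n) x]); last first.
  apply/seteqP; split=> [x [n _]|x [t tx]].
    rewrite (CP n).2 => -[t tx].
    by exists (fun i => if i is i'.+1 then t i' else n).
  by exists (t 0%N) => //; rewrite (CP _).2; exists (t \o succn).
apply: (@souslin_local _ _ succn) => [n t|n t t' tt']; first exact: (CP _).1.
rewrite tt' //; congr (C _ _ _).
by apply/eq_in_map => i; rewrite mem_iota => /andP[_ lt]; exact: tt'.
Qed.

(** A single branch interleaves, through [pickle], one branch for each set. *)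
Lemma souslin_bigcap (A : nat -> set X) :
  (forall n, souslin (A n)) -> souslin (\bigcap_n A n).
Proof.
move=> sA; have /choice[C CP] n : exists C : seq nat -> set X,
    (forall s, closed (C s)) /\ A n = [set x | exists t, forall n, C (mkseq t
      n) x].
  by have [C] := sA n; exists C.
pose part (t : nat -> nat) (i k : nat) := t (pickle (i, k)).
rewrite (_ : \bigcap_n _ = [set x | exists t, forall j : nat * nat,
    C j.1 (mkseq (part t j.1) j.2) x]); last first.
  apply/seteqP; split=> [x Ax|x [t tx] n _]; last first.
    by rewrite (CP n).2; exists (part t n) => m; exact: (tx (n, m)).
  have /choice[t tP] n : exists t, forall m, C n (mkseq t m) x.
    by have := Ax n I; rewrite (CP n).2.
  exists (fun p => if unpickle p is Some (i, k) then t i k else 0%N) => -[n m]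
    /=.
  rewrite (_ : mkseq _ m = mkseq (t n) m) //.
  by apply: eq_map => k; rewrite /part pickleK.
pose N (j : nat * nat) := (\max_(k < j.2) (pickle (j.1, nat_of_ord k)).+1)%N.
apply: (@souslin_local _ _ N) => [j t|j t t' tt']; first exact: (CP _).1.
congr (C _ _ _); apply/eq_in_map => k; rewrite mem_iota => /andP[_ lt].
by apply: tt'; exact: (@leq_bigmax _ (fun k :
  'I_j.2 => (pickle (j.1, nat_of_ord k)).+1) (Ordinal lt)).
Qed.

Lemma souslinI (A B : set X) : souslin A -> souslin B -> souslin (A `&` B).
Proof.
move=> sA sB.
rewrite (_ : _ `&` _ = \bigcap_n (if n is 0%N then A else B)).
  by apply: souslin_bigcap => -[].
apply/seteqP; split=> [x [Ax Bx] [] //|x h].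
by split; [exact: (h 0%N)|exact: (h 1%N)].
Qed.

End Souslin.

(** Closures along a branch suffice: if [x] lies in all of them, an ultrafilter containing the
    neighborhoods of [x] and the sets of the branch converges both to [x] and to a point of all
    these sets, and limits are unique. *)
Lemma scheme_souslin (X : topologicalType) (D : seq nat -> set X) s :
  hausdorff_space X -> scheme D -> souslin (D s).
Proof.
move=> hX [Dcup Dcvg].
have Dtake t n : D t `<=` D (take n t).
  elim/last_ind: t => [|t k IH]; first by case: n => [|n] x.
  have [le|gt] := leqP n (size t); last by rewrite take_oversize // size_rcons.
  rewrite -{2}cats1 takel_cat //; apply: subset_trans IH => x Dx.
  by rewrite Dcup; exists k.
pose E n (t : nat -> nat) : set X :=
  if mkseq t (size s) == s then closure (D (mkseq t n)) else set0.
rewrite (_ : D s = [set x | exists t, forall n, E n t x]).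
  apply: (@souslin_local _ _ E (maxn (size s))) => [n t|n t t' tt'].
    by rewrite /E; case: ifP => _; [exact: closed_closure|exact: closed0].
  have mk m : (m <= maxn (size s) n)%N -> mkseq t m = mkseq t' m.
    move=> le; apply/eq_in_map => i; rewrite mem_iota => /andP[_ lt].
    by apply: tt'; exact: leq_trans le.
  by rewrite /E !mk ?leq_maxl ?leq_maxr.
apply/seteqP; split=> [x Dx|x [t tx]].
  have /choice[k kP] u : exists k, D u x -> D (rcons u k) x.
    have [Du|nD] := pselect (D u x); last by exists 0%N.
    by move: (Du); rewrite Dcup => -[k _ Dk]; exists k.
  pose b := fix b n := if n is n'.+1 then
    rcons (b n') (if (n' < size s)%N then nth 0%N s n' else k (b n')) else [::].
  pose t n := if (n < size s)%N then nth 0%N s n else k (b n).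
  have bt n : mkseq t n = b n by elim: n => // n IH; rewrite mkseqS IH.
  have bs n : (n <= size s)%N -> b n = take n s.
    elim: n => [|n IH] le; first by rewrite take0.
    by rewrite (take_nth 0%N le) /= le IH // ltnW.
  have bD n : D (b n) x.
    elim: n => [|n IH]; first by have := Dtake s 0%N x Dx; rewrite take0.
    have [le|gt] := ltnP n (size s); first by rewrite bs //; exact: Dtake.
    by rewrite /= ltnNge gt /=; exact: kP.
  exists t => n; rewrite /E bt bs // take_size eqxx bt; exact: subset_closure.
have ts : mkseq t (size s) = s by have := tx 0%N; rewrite /E; case: eqP.
have {}tx n : closure (D (mkseq t n)) x by have := tx n; rewrite /E ts eqxx.
have decr n m : (n <= m)%N -> D (mkseq t m) `<=` D (mkseq t n).
  move=> le; suff -> : mkseq t n = take n (mkseq t m) by exact: Dtake.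
  by rewrite /mkseq -map_take take_iota (minn_idPl le).
pose F0 := filter_from [set p : set X * nat | nbhs x p.1]
  (fun p => p.1 `&` D (mkseq t p.2)).
have PF : ProperFilter F0.
  apply: filter_from_proper.
    apply: filter_from_filter; first by exists (setT, 0%N); exact: filterT.
    move=> [P n] [Q m] nP nQ; exists (P `&` Q, maxn n m); first exact: filterI.
    move=> z [[Pz Qz] Dz]; split; split=> //; apply: decr Dz.
      exact: leq_maxl.
    exact: leq_maxr.
  move=> [P n] /= nP; have [y [Dy Py]] := tx n _ nP.
  by exists y.
have [G [UG FG]] := ultraFilterLemma PF.
have [|y [Gy Dy]] := Dcvg G t UG.
  by move=> n; apply: FG; exists (setT, n); [exact: filterT|move=> z []].
suff -> : x = y by rewrite -ts; exact: Dy.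
apply: (cvg_unique hX _ Gy) => P nP; apply: FG.
by exists (P, 0%N) => // z [].
Qed.

Lemma KAnalytic_souslin (X : topologicalType) (A : set X) :
  hausdorff_space X -> KAnalytic_set A -> souslin A.
Proof. by move=> hX /KAnalytic_has_scheme[D sD <-]; exact: scheme_souslin. Qed.

Lemma hausdorff_prod (U V : topologicalType) :
  hausdorff_space U -> hausdorff_space V -> hausdorff_space (U * V)%type.
Proof.
move=> hU hV [a b] [c d] cl; congr (_, _).
  apply: hU => A B nA nB.
  have [||[x y] [/= Ax Bx]] := cl (fst @^-1` A) (fst @^-1` B); last by exists x.
  - exact: (@cvg_fst _ _ (nbhs a) (nbhs b)).
  - exact: (@cvg_fst _ _ (nbhs c) (nbhs d)).
apply: hV => A B nA nB.
have [||[x y] [/= Ay By]] := cl (snd @^-1` A) (snd @^-1` B); last by exists y.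
- exact: (@cvg_snd _ _ (nbhs a) (nbhs b)).
- exact: (@cvg_snd _ _ (nbhs c) (nbhs d)).
Qed.

(* If [X = f @` Z] with [Z] in a compact [K], the Souslin set [A] is the image
   of a closed subset of [Z * nat^nat], and [nat^nat] embeds as a G_delta in the
   Cantor cube by sending a sequence to its graph. *)
Lemma souslin_KAnalytic (X : topologicalType) (A : set X) :
  KAnalytic_space X -> souslin A -> KAnalytic_set A.
Proof.
move=> [_ [Z [f [LZ [cZ [cf fT]]]]]] [C cC AE].
have [K [e [ O [F [[cK hK] [ce [ie oe]] [oO eO] FP Fe]]]]] :=
  cech_lindelof_compact LZ cZ.
pose Cb := prod_topology (fun _ : nat * nat => bool).
pose KC := (K * Cb)%type.
have cKC : compact [set: KC].
  rewrite -setXTT; apply: compact_setX => //.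
  have := @function_spaces.tychonoff (nat * nat)%type (fun=> bool) (fun=> setT).
  rewrite (_ : [set g | _] = setT); last by apply/seteqP; split.
  by apply=> _; exact: bool_compact.
have hKC : hausdorff_space KC.
  apply: hausdorff_prod => //; apply: (@hausdorff_product _ (fun=> bool)) => _.
  exact: discrete_hausdorff.
have oev (p : nat * nat) : open [set x : KC | x.2 p = true].
  have := @open_comp KC bool (fun x => x.2 p) [set true]; apply.
    move=> x _; apply: (@continuous_comp _ _ _ snd (fun c : Cb => c p)).
      exact: cvg_snd.
    exact: (@proj_continuous _ (fun=> bool) p).
  exact: discrete_open.
have cev (p : nat * nat) : closed [set x : KC | x.2 p = true].
  apply: (@preimage_closed KC bool (fun x => x.2 p) [set true]).
    move=> x _; apply: (@continuous_comp _ _ _ snd (fun c : Cb => c p)).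
      exact: cvg_snd.
    exact: (@proj_continuous _ (fun=> bool) p).
  exact: discrete_closed.
pose graph (t : nat -> nat) : Cb := fun p => p.2 == t p.1.
pose T0 := [set x : KC | exists z t, (forall n, C (mkseq t n) (f z)) /\ x = (e
  z, graph t)].
pose H := closure T0.
pose O' n := fst @^-1` O n `&` \bigcup_m [set x : KC | x.2 (n, m) = true].
pose pr k : nat * nat := odflt (0, 0)%N (unpickle k).
pose F' n k := fst @^-1` F n (pr k).1 `&` [set x :
  KC | x.2 (n, (pr k).2) = true].
pose T := H `&` \bigcap_n O' n.
(* In the closure [H] a row has at most one entry, in [O' n] row [n] has at least one, so the limit
   is again a graph. The sets [C] being closed, their conditions pass to the limit. *)
have TP x : T x -> exists z t, (forall n, C (mkseq t n) (f z)) /\ x = (e z,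
  graph t).
  case: x => p c [Hx Ox].
  have [z _ ez] : range e p by rewrite eO => n _; have [] := Ox n I.
  have /choice[t tP] n : exists m, c (n, m) = true by have [_ [m]] := Ox n I;
    exists m.
  have near_t n : nbhs ((p, c) : KC) [set x | forall i :
    'I_n, x.2 (val i, t (val i)) = true].
    apply: (@filter_forall _ 'I_n (fun i =>
      [set x : KC | x.2 (val i, t (val i)) = true]) _ (nbhs_filter _)) => i.
    apply: open_nbhs_nbhs; split; first exact: oev.
    exact: tP.
  exists z, t; split; last first.
    congr (_, _); first by rewrite ez.
    apply/funext => -[n m]; rewrite /graph /=.
    have [->|ne] := eqVneq m (t n); first exact: tP.
    case cnm : (c (n, m)) => //; exfalso.
    have nb : nbhs ((p, c) : KC) [set x | x.2 (n, m) = true].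
      by apply: open_nbhs_nbhs; split=> //; exact: oev.
    have [_ [[z' [t' [_ ->]]] [/= /eqP e1 /(_ (Ordinal (ltnSn n))) /= /eqP
      e2]]] :=
      Hx _ (filterI nb (near_t n.+1)).
    by move/eqP: ne; apply; exact: (etrans e1 (esym e2)).
  move=> n; apply: contrapT => nC.
  have nfz : nbhs (f z) (~` C (mkseq t n)).
    by apply: open_nbhs_nbhs; split=> //; rewrite openC.
  have [U [oU Uz UC]] : exists U,
      [/\ open U, U z & U `<=` f @^-1` (~` C (mkseq t n))].
    by have := cf z _ nfz; rewrite /= nbhsE => -[U [oU Uz] UC]; exists U.
  have [V [oV eV]] := oe _ oU.
  have Vp : V p by have [] : (V `&` range e) p by rewrite -eV -ez; exists z.
  have nV : nbhs ((p, c) : KC) (fst @^-1` V).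
    apply: (@cvg_fst _ _ (nbhs p) (nbhs c)); exact: open_nbhs_nbhs.
  have [_ [[z' [t' [Cz' ->]]] [/= Vz' tt']]] := Hx _ (filterI nV (near_t n)).
  have [z2 Uz2 /ie z2z'] : (e @` U) (e z') by rewrite eV; split=> //; exists z'.
  apply: (UC z'); first by rewrite -z2z'.
  rewrite (_ : mkseq t n = mkseq t' n); first exact: Cz'.
  apply/eq_in_map => i; rewrite mem_iota => /andP[_ lt].
  by have /eqP := tt' (Ordinal lt).
have T0T : T0 `<=` T.
  move=> _ [z [t [Ct ->]]]; split; first by apply: subset_closure; exists z, t.
  move=> n _; split=> /=; first by have : range e (e z) by [exists z];
    rewrite eO; exact.
  by exists (t n) => //=; rewrite /graph eqxx.
have cO' n : open (O' n).
  apply: openI; last by apply: bigcup_open => m _; exact: oev.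
  by apply: open_comp => // x _; exact: cvg_fst.
have cF' n k : closed (F' n k).
  apply: closedI => //; apply: preimage_closed => [x _|]; first exact: cvg_fst.
  exact: (FP _ _).1.
have TF : T = H `&` \bigcap_n \bigcup_k F' n k.
  apply/seteqP; split=> [x Tx|x [Hx Fx]].
    split=> [|n _]; first exact: Tx.1.
    have [z [t [_ ->]]] := TP _ Tx; have [k Fk] := Fe z n.
    by exists (pickle (k, t n)) => //; rewrite /F' /pr pickleK /=; split=> //=;
      rewrite /graph eqxx.
  split=> // n _; have [k _ [Fk xk]] := Fx n I.
  by split; [exact: (FP _ _).2 Fk|exists (pr k).2].
have /choice[g gP] (x : T) : exists z, exists t,
    (forall n, C (mkseq t n) (f z)) /\ set_val x = (e z, graph t).
  exact: TP (set_valP x).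
exists T, (f \o g); split.
  exact: (lindelof_set_type cKC (@closed_closure _ _) cF' TF).
split; first exact: (cech_complete_set_type cKC hKC (@closed_closure _ _) cO'
  erefl).
split.
  move=> x N nN; have [t [_ xE]] := gP x.
  have := cf _ _ nN; rewrite /= nbhsE => -[U [oU Uz] UN].
  have [V [oV eV]] := oe _ oU.
  have Vp : V (set_val x).1.
    rewrite xE /=.
    by have [] : (V `&` range e) (e (g x)) by rewrite -eV; exists (g x).
  have nV : nbhs (set_val x) (fst @^-1` V).
    rewrite [set_val x]surjective_pairing.
    apply: (@cvg_fst _ _ (nbhs (set_val x).1) (nbhs (set_val x).2)).
    exact: open_nbhs_nbhs.
  apply: filterS (set_type_nbhs nV) => y /= Vy; have [t' [_ yE]] := gP y.
  rewrite yE /= in Vy.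
  have [z2 Uz2 /ie <-] : (e @` U) (e (g y)) by rewrite eV; split=> //;
    exists (g y).
  exact: UN.
rewrite AE; apply/seteqP; split=> [_ [x _ <-]|x [t Ct]].
  by have [t [Ct _]] := gP x; exists t.
have [z _ zx] : range f x by rewrite fT.
have Tz : T (e z, graph t) by apply: T0T; exists z, t; rewrite zx.
pose y : T := exist _ (e z, graph t) (mem_set Tz).
exists y => //=; have [t' [_ [/ie yz _]]] := gP y.
by rewrite -yz.
Qed.

Lemma KAnalytic_scheme (X : topologicalType) (A : set X) :
  KAnalytic_space X -> KAnalytic_set A ->
  exists D, [/\ scheme D, D [::] = A & forall s, KAnalytic_set (D s)].
Proof.
move=> KX /KAnalytic_has_scheme[D sD DA]; exists D; split=> // s.
by apply: souslin_KAnalytic => //; apply: scheme_souslin => //; exact: KX.1.1.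
Qed.

Lemma KAnalytic_setI (X : topologicalType) (A B : set X) :
  KAnalytic_space X -> KAnalytic_set A -> KAnalytic_set B ->
  KAnalytic_set (A `&` B).
Proof.
move=> KX KA KB; apply: souslin_KAnalytic => //.
by apply: souslinI; apply: KAnalytic_souslin => //; exact: KX.1.1.
Qed.

(** * Functionally Borel and functionally analytic sets are Souslin *)

Lemma open_Fsigma (R : realType) (M : pseudoMetricType R) (O : set M) :
  open O -> Fsigma O.
Proof.
move=> oO; pose e n : R := (n.+1%:R^-1)%R.
have e0 n : (0 < e n)%R by rewrite invr_gt0 ltr0n.
exists (fun n => closure [set y | ball y (e n) `<=` O]).
  by move=> n; exact: closed_closure.
apply/seteqP; split=> [y Oy|y [n _ cy]].
  have /nbhs_ballP[d /= d0 dO] := open_nbhs_nbhs (conj oO Oy).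
  have [n _ /(_ n (leqnn n)) nd] := near_infty_natSinv_lt (PosNum d0).
  exists n => //; apply: subset_closure => z yz; apply: dO.
  by apply: le_ball yz; exact: ltW.
have [z [zO yz]] := cy _ (nbhsx_ballx y (e n) (e0 n)).
by apply: zO; exact: ball_sym.
Qed.

Lemma ptws_nat_nbhs (t : Defs.Baire) (U : set Defs.Baire) : nbhs t U ->
  exists n, [set r | forall i, (i < n)%N -> r i = t i] `<=` U.
Proof.
pose cyl n : set Defs.Baire := [set r | forall i, (i < n)%N -> r i = t i].
pose F : set_system Defs.Baire := filter_from setT cyl.
have FF : Filter F.
  apply: filter_fromT_filter; first by exists 0%N.
  move=> n m; exists (maxn n m) => r rt.
  by split=> i lt; apply: rt; rewrite leq_max lt ?orbT.
suff Ft : F --> t by move=> /Ft[n _ ?]; exists n.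
apply/cvg_sup => i A /=; rewrite (@nbhsE (initial_topology _)) => -[B [[W oW
  <-] Wt] WA].
exists i.+1 => // r rt; apply: WA; rewrite /= rt //.
Qed.

(** By continuity and the Hausdorff property, the closures of the images under [phi] of the
    cylinders around [t] meet only in [phi t]. *)
Lemma fanalytic_souslin (X : topologicalType) (A : set X) :
  fanalytic A -> souslin A.
Proof.
case=> g [B [cg [[->|[phi [cphi <-]]] ->]]].
  by rewrite preimage_set0; apply: souslin_closed; exact: closed0.
pose E n (t : Defs.Baire) : set X :=
  g @^-1` closure (phi @` [set r | forall i, (i < n)%N -> r i = t i]).
rewrite (_ : _ @^-1` _ = [set x | exists t, forall n, E n t x]).
  apply: (@souslin_local _ _ E id) => [n t|n t t' tt'].
    apply: preimage_closed => [x _|]; first exact: cg.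
    exact: closed_closure.
  by congr (_ @^-1` closure (_ @` _)); apply/seteqP; split=> r rt i lt;
    rewrite rt // tt'.
apply/seteqP; split=> [x [t _ tx]|x [t tx]].
  by exists t => n; apply: subset_closure; exists t.
exists t => //.
have hR : hausdorff_space Romega.
  by apply: hausdorff_product => _; exact: Rhausdorff.
apply: hR => P Q nP nQ; have [n nphi] := ptws_nat_nbhs (cphi t P nP).
have [_ [[r rt <-] Qr]] := tx n Q nQ.
by exists (phi r); split=> //; exact: nphi.
Qed.

(** The sets whose preimage is Souslin together with its complement form a sigma-algebra. It
    contains the open sets, which are F_sigma in [Romega]. *)
Lemma fBorel_souslin (X : topologicalType) (A : set X) :
  fBorel A -> souslin A /\ souslin (~` A).
Proof.
case=> g [B [cg [BB ->]]].
suff : [set B | souslin (g @^-1` B) /\ souslin (g @^-1` (~` B))] B by [].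
apply: BB; split.
  split.
  - rewrite /= setC0 preimage_set0 preimage_setT.
    by split; apply: souslin_closed; [exact: closed0|exact: closedT].
  - by move=> D [sD sCD]; rewrite /= setTD setCK.
  - move=> D sD; rewrite /= setC_bigcup preimage_bigcup preimage_bigcap.
    by split; [apply: souslin_bigcup|apply: souslin_bigcap] => n; have [] :=
      sD n.
move=> O /= oO; split; last first.
  apply: souslin_closed; apply: preimage_closed => [x _|]; first exact: cg.
  by rewrite closedC.
have [F cF ->] := @open_Fsigma Rdefinitions.R Romega O oO.
rewrite preimage_bigcup; apply: souslin_bigcup => n; apply: souslin_closed.
by apply: preimage_closed => [x _|]; [exact: cg|exact: cF].
Qed.

(** * Bernstein sets *)

Lemma well_order_least (T : eqType) (R : rel T) (A : set T) :
  well_order R -> A !=set0 -> exists2 x, A x & forall y, A y -> R x y.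
Proof.
move=> wR [a Aa]; have [|x [[Ax lx] _]] := wR [pred x | `[<A x>]].
  by exists a; apply/asboolP.
exists x; first exact/asboolP.
by move=> y Ay; apply: lx; exact/asboolP.
Qed.

(* Taking for [<] an order in which no proper initial segment contains a copy
   of [T] is what makes the transfinite choice of [transversal] possible. *)
Lemma initial_order (T : eqType) : exists lt : T -> T -> Prop,
  [/\ well_founded lt, forall x y, [\/ lt x y, x = y | lt y x] &
      forall i (f : T -> T), injective f -> exists a, ~ lt (f a) i].
Proof.
have [R wR] := well_ordering_principle T.
pose lt x y := R x y /\ x <> y.
have anti x y : R x y -> R y x -> x = y.
  move=> xy yx; have [|z [[_ _] uz]] := wR [pred z | (z == x) || (z == y)].
    by exists x; rewrite inE /= eqxx.
  have rr a : R a a.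
    have [|b -> +] := @well_order_least _ R [set a] wR; first by exists a.
    exact.
  rewrite -(uz x); last first.
    split; first by rewrite inE /= eqxx.
    by move=> b /orP[/eqP ->|/eqP ->].
  apply: uz; split; first by rewrite inE /= eqxx orbT.
  by move=> b /orP[/eqP ->|/eqP ->].
have wf : well_founded lt.
  apply: contrapT => nwf.
  have [|x nx lx] := @well_order_least _ R [set x | ~ Acc lt x] wR.
    by apply: contrapT => n0; apply: nwf => x; apply: contrapT => nx;
      apply: n0; exists x.
  apply: nx; constructor => y [yx ne]; apply: contrapT => ny.
  by apply: ne; apply: anti => //; exact: lx.
have tri x y : [\/ lt x y, x = y | lt y x].
  have [->|/eqP ne] := eqVneq x y; first exact: Or32.
  have [|b [->|->] lb] := @well_order_least _ R [set x; y] wR.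
  - by exists x; left.
  - by apply: Or31; split => //; apply: lb; right.
  - by apply: Or33; split => [|/esym//]; apply: lb; left.
(* [i] is bad if the segment below it contains a copy of [T]. If there is a bad [i], the order is
   pulled back along an embedding [f] into the segment of the least one. *)
pose bad i := exists2 f : T -> T, injective f & forall a, lt (f a) i.
have [nobad|] := pselect (forall i, ~ bad i).
  exists lt; split => // i f fi; apply: contrapT => n; apply: (nobad i).
  by exists f => // a; apply: contrapT => na; apply: n; exists a.
move=> /existsNP[i0 /contrapT bi0].
have [|i [f fi fl] li] := @well_order_least _ R bad wR; first by exists i0.
exists (fun x y => lt (f x) (f y)); split.
- exact: (wf_inverse_image _ _ _ f wf).
- by move=> x y; have [|/fi|] := tri (f x) (f y);
  [exact: Or31|exact: Or32|exact: Or33].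
- move=> j g gi; apply: contrapT => n.
  have [fj ne] := fl j; apply: ne; apply: anti => //; apply: li.
  exists (f \o g); first exact: inj_comp.
  by move=> a; apply: contrapT => na; apply: n; exists a.
Qed.

(** Transfinite recursion chooses [g i] in [F i] away from all earlier values. If these exhausted
    the copy of [T] in [F i], sending each of its points to the index of its value would inject [T]
    into a proper initial segment. *)
Lemma transversal (T : choiceType) (F : T -> set T) :
  (forall i, exists2 f : T -> T, injective f & forall a, F i (f a)) ->
  exists2 g : T -> T, injective g & forall i, F i (g i).
Proof.
move=> FT; have [lt [wf tri big]] := initial_order T.
pose step i (rec : forall j, lt j i -> T) :=
  xget i [set x | F i x /\ forall j (h : lt j i), x <> rec j h].
pose g := Fix wf (fun=> T) step.
have gE i : F i (g i) /\ forall j, lt j i -> g i <> g j.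
  have -> : g i = step i (fun j _ => g j).
    rewrite /g Fix_eq // => x f h fh; rewrite /step; congr (xget _ _).
    by apply/seteqP; split=> y [Fy ny]; split=> // j hj;
      [rewrite -fh; exact: ny|rewrite fh; exact: ny].
  apply: (@xgetPex _ i [set x | F i x /\ forall j, lt j i -> x <> g j]).
  apply: contrapT => n.
  have [f fi Ff] := FT i.
  have /choice[k kP] a : exists j, lt j i /\ f a = g j.
    apply: contrapT => na; apply: n; exists (f a); split=> // j ji e.
    by apply: na; exists j.
  have ki : injective k by move=> a b e; apply: fi; rewrite (kP a).2 (kP b).2 e.
  by have [a] := big i k ki; apply; exact: (kP a).1.
exists g => [x y e|i]; last exact: (gE i).1.
by have [/(proj2 (gE y))|//|/(proj2 (gE x))] := tri x y; rewrite e.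
Qed.

(** Each [F i] is listed twice, under the indices [cons false i] and [cons true i]. A transversal of
    the doubled family gives two points of [F i], of which [S] takes exactly one. *)
Lemma bernstein (F : (nat -> bool) -> set (nat -> bool)) :
  (forall i, exists2 f : (nat -> bool) -> (nat -> bool),
     injective f & forall a, F i (f a)) ->
  exists S : set (nat -> bool), forall i, ~ F i `<=` S /\ ~ F i `<=` ~` S.
Proof.
move=> FT; have [|g gi Fg] := @transversal (nat -> bool)
  (fun c => F (c \o succn)).
  by move=> c; exact: FT.
pose cons b (i : nat -> bool) n := if n is n'.+1 then i n' else b.
have consE b i : F i (g (cons b i)) by exact: (Fg (cons b i)).
exists (g @` [set c : nat -> bool | c 0 = true]) => i; split=> FS.
  by have [c /= c0 /gi e] := FS _ (consE false i); move: c0; rewrite e.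
by apply: (FS _ (consE true i)); exists (cons true i).
Qed.

(** * Families of negligible sets indexed by the Cantor space *)

Section Ideal.
Context (X : topologicalType) (x0 : X) (I : set (set X))
  (sI : sigma_ideal I).

Lemma ideal_sub (A B : set X) : A `<=` B -> I B -> I A.
Proof. by case: sI => _ [h _]; exact: h. Qed.

Lemma ideal0 : I set0.
Proof.
have [A IA _] : (\bigcup_(A in I) A) x0 by case: sI => _ [_ [-> _]].
exact: ideal_sub IA.
Qed.

Lemma ideal_bigcup (T : countType) (F : T -> set X) :
  (forall t, I (F t)) -> I (\bigcup_t F t).
Proof.
move=> IF; pose G n := if unpickle n is Some t then F t else set0.
apply: (@ideal_sub _ (\bigcup_n G n)).
  by move=> x [t _ Ft]; exists (pickle t); rewrite // /G pickleK.
case: sI => h _; apply: h => n; rewrite /G.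
by case: (unpickle n) => [t|]; [exact: IF|exact: ideal0].
Qed.

Lemma ideal_bigcupN (T : countType) (A : set X) (F : T -> set X) :
  ~ I A -> A `<=` \bigcup_t F t -> exists t, ~ I (F t).
Proof.
move=> nA AF; apply: contrapT => n; apply: nA; apply: ideal_sub AF _.
by apply: ideal_bigcup => t; apply: contrapT => nt; apply: n; exists t.
Qed.

Lemma idealU (A B : set X) : I A -> I B -> I (A `|` B).
Proof.
move=> IA IB; apply: (@ideal_sub _ (\bigcup_(b : bool) (if b then A else B))).
  by move=> x [?|?]; [exists true|exists false].
by apply: ideal_bigcup => -[].
Qed.

End Ideal.

Definition cyl (w : seq bool) : set (nat -> bool) :=
  [set r | mkseq r (size w) = w].

Section FourPoles.
Context (X : topologicalType) (x0 : X) (I : set (set X)) (q : X -> nat -> bool)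
  (P : set X).
Hypothesis KX : KAnalytic_space X.
Hypothesis sI : sigma_ideal I.
Hypothesis qsemi : forall S, semimeasurable_set I (P `&` q @^-1` S).
Hypothesis qnull : forall r, I (P `&` q @^-1` [set r]).

(** Otherwise at most one cylinder of each length from [N] on is non-negligible on [A]. The points
    of [A] all of whose cylinders from there on are non-negligible share one value of [q]; the other
    points lie in countably many negligible pieces. *)
Lemma split_cyl (A : set X) (N : nat) : A `<=` P -> ~ I A ->
  exists w0 w1, [/\ w0 != w1, size w0 = size w1, (N <= size w0)%N,
    ~ I (A `&` (P `&` q @^-1` cyl w0)) & ~ I (A `&` (P `&` q @^-1` cyl w1))].
Proof.
move=> AP nA; apply: contrapT => nw.
have uniq w w' : (N <= size w)%N -> size w = size w' ->
    ~ I (A `&` (P `&` q @^-1` cyl w)) -> ~ I (A `&` (P `&` q @^-1` cyl w')) ->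
    w = w'.
  move=> Nw ww' nIw nIw'; have [//|ne] := eqVneq w w'.
  by exfalso; apply: nw; exists w, w'.
apply: nA.
pose R := [set x | A x /\ forall n, (N <= n)%N ->
  ~ I (A `&` (P `&` q @^-1` cyl (mkseq (q x) n)))].
pose F w := [set x | A x /\ cyl w (q x) /\ I (A `&` (P `&` q @^-1` cyl w))].
apply: (@ideal_sub _ _ sI _ (R `|` \bigcup_w F w)).
  move=> x Ax; have [Rx|nRx] := pselect (R x); first by left.
  right; have : ~ forall n, (N <= n)%N ->
      ~ I (A `&` (P `&` q @^-1` cyl (mkseq (q x) n))) by move=> h; apply: nRx.
  move=> /existsNP[n /not_implyP[_ /contrapT In]].
  by exists (mkseq (q x) n) => //; split=> //; split=> //;
    rewrite /cyl /= size_mkseq.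
apply: (idealU x0 sI).
  have [[x [Ax xR]]|R0] := pselect (exists x, R x).
    apply: ideal_sub (qnull (q x)) => // y [Ay yR]; split; first exact: AP.
    apply/funext => n.
    have := uniq (mkseq (q y) (N + n.+1)) (mkseq (q x) (N + n.+1)).
    rewrite !size_mkseq leq_addr => /(_ erefl erefl).
    move=> /(_ (yR _ (leq_addr _ _)) (xR _ (leq_addr _ _))).
    move=> /(congr1 (fun s => nth false s n)).
    by rewrite !nth_mkseq // addnS ltnS leq_addl.
  by apply: ideal_sub (ideal0 x0 sI) => // x Rx; apply: R0; exists x.
apply: (ideal_bigcup x0 sI) => w.
have [Iw|nIw] := pselect (I (A `&` (P `&` q @^-1` cyl w))).
  by apply: ideal_sub Iw => // x [Ax [cx _]]; split=> //; split=> //; exact: AP.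
by apply: ideal_sub (ideal0 x0 sI) => // x [_ [_ /nIw]].
Qed.

(* A node of the fusion tree: a non-negligible K-analytic set with a scheme,
   on which [q] takes its values in one cylinder. *)
Let node := ((seq nat -> set X) * seq bool)%type.

Let good (u : node) := [/\ scheme u.1, forall s, KAnalytic_set (u.1 s),
  ~ I (u.1 [::]) & u.1 [::] `<=` P `&` q @^-1` cyl u.2].

(** The scheme of [v] lives inside one first-level piece of that of [u], with [f] translating
    indices, so that a chain of refinements traces a branch in each of its schemes. *)
Let refines (u v : node) := exists (j : nat) (f : nat -> nat),
  forall s, v.1 s `<=` u.1 (j :: map f s).

Lemma node_child (A : set X) w : KAnalytic_set A ->
  ~ I (A `&` (P `&` q @^-1` cyl w)) ->
  exists B, [/\ KAnalytic_set B, B `<=` A, B `<=` P `&` q @^-1` cyl w & ~ I B].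
Proof.
move=> KA nA; have [B [KB [BA nB]]] := qsemi KA nA.
by exists B; split=> // x /BA[].
Qed.

(** The part of [D] below [j] is intersected with a scheme of [B], each new index coding a pair of
    old ones. The limits from the two schemes agree because [X] is Hausdorff. *)
Lemma node_refine (D : seq nat -> set X) j (B : set X) : scheme D ->
  (forall s, KAnalytic_set (D s)) -> KAnalytic_set B -> B `<=` D [:: j] ->
  exists E, [/\ scheme E, forall s, KAnalytic_set (E s), E [::] = B &
    exists f, forall s, E s `<=` D (j :: map f s)].
Proof.
move=> [Dcup Dcvg] KD KB BD; have [C [[Ccup Ccvg] C0 KC]] :=
  KAnalytic_scheme KX KB.
pose p (n : nat) : nat * nat := odflt (0, 0)%N (unpickle n).
have pK a b : p (pickle (a, b)) = (a, b) by rewrite /p pickleK.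
pose f1 n := (p n).1; pose f2 n := (p n).2.
exists (fun s => D (j :: map f1 s) `&` C (map f2 s)); split.
- split=> [s|G s UG GD].
    apply/seteqP; split=> [x [Dx Cx]|x [n _ []]].
      move: Dx; rewrite Dcup => -[a _ Da]; move: Cx; rewrite Ccup => -[b _ Cb].
      exists (pickle (a, b)) => //; rewrite !map_rcons /f1 /f2 pK /=.
      by split; [exact: Da|exact: Cb].
    rewrite /= !map_rcons -rcons_cons => Dx Cx; split.
      by rewrite Dcup; exists (f1 n).
    by rewrite Ccup; exists (f2 n).
  have mapk (g : nat -> nat) n : map g (mkseq s n) = mkseq (g \o s) n.
    by rewrite /mkseq -map_comp.
  have [|y [Gy Cy]] := Ccvg G (f2 \o s) UG.
    by move=> n; rewrite -mapk; apply: filterS (GD n) => x [].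
  have [|z [Gz Dz]] := Dcvg G (fun n => if n is n'.+1 then f1 (s n') else j) UG.
    case=> [|n]; first by apply: filterS (GD 0%N) => x [Dx _]; rewrite /= Dcup;
      exists j.
    rewrite /mkseq /= -[1%N]add1n iotaDl -map_comp.
    by apply: filterS (GD n) => x [+ _]; rewrite mapk.
  have zy : z = y by apply: (cvg_unique KX.1.1 Gz Gy).
  exists y; split=> // n; split; last by rewrite mapk; exact: Cy.
  have := Dz n.+1; rewrite /mkseq /= -[1%N]add1n iotaDl -map_comp zy.
  by rewrite -map_comp.
- by move=> s; apply: KAnalytic_setI.
- by rewrite /= C0; apply/setIidr.
- by exists f1 => s x [].
Qed.

(** Some piece [D [:: j]] is non-negligible. Two longer cylinders split it, and semimeasurability
    puts a non-negligible K-analytic set into each part. *)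
Lemma node_split (u : node) : good u -> exists uv : node * node,
  [/\ good uv.1, good uv.2, refines u uv.1, refines u uv.2 &
    [/\ uv.1.2 != uv.2.2, size uv.1.2 = size uv.2.2 & (size u.2 < size
      uv.1.2)%N]].
Proof.
case: u => D w [/= schD KD nD DP].
have [|j nj] := @ideal_bigcupN _ x0 _ sI _ (D [::]) (fun j => D [:: j]) nD.
  by rewrite {1}schD.1.
have DjP : D [:: j] `<=` P.
  by move=> x Dx; apply: (DP x _).1; rewrite schD.1; exists j.
have [w0 [w1 [ne sz lt n0 n1]]] := split_cyl (size w).+1 DjP nj.
have [B0 [KB0 BD0 BP0 nB0]] := node_child (KD _) n0.
have [B1 [KB1 BD1 BP1 nB1]] := node_child (KD _) n1.
have [E0 [s0 K0 E00 [f0 F0]]] := node_refine schD KD KB0 BD0.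
have [E1 [s1 K1 E10 [f1 F1]]] := node_refine schD KD KB1 BD1.
exists ((E0, w0), (E1, w1)); split=> //=.
- by split; rewrite //= E00.
- by split; rewrite //= E10.
- by exists j, f0.
- by exists j, f1.
Qed.
(** The later roots follow one branch of the scheme of [u n], so an ultrafilter containing all roots
    has a limit in the root of each [u n], the same for all [n]. *)
Lemma node_limit (u : nat -> node) :
  (forall n, good (u n)) -> (forall n, refines (u n) (u n.+1)) ->
  exists y, forall n, (u n).1 [::] y.
Proof.
move=> gu /choice[j /choice[f uf]].
(* [sg k n] is term [k] of the branch that later nodes trace in the scheme of [u n]. *)
pose sg := fix sg k n := if k is k'.+1 then f n (sg k' n.+1) else j n.
have sgS m n : mkseq (sg^~ n) m.+1 = j n :: map (f n) (mkseq (sg^~ n.+1) m).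
  by rewrite /mkseq /= -[1%N]add1n iotaDl -!map_comp.
have sub m n : (u (n + m)).1 [::] `<=` (u n).1 (mkseq (sg^~ n) m).
  elim: m n => [|m IH] n; first by rewrite addn0.
  rewrite sgS addnS -addSn; apply: subset_trans (IH _) _; exact: uf.
have dec n m : (n <= m)%N -> (u m).1 [::] `<=` (u n).1 [::].
  elim: m => [|m IH]; first by rewrite leqn0 => /eqP ->.
  rewrite leq_eqVlt => /orP[/eqP -> //|]; rewrite ltnS => /IH;
    apply: subset_trans.
  move=> x /uf Dx; have [[Dcup _] _ _ _] := gu m.
  by rewrite Dcup; exists (j m).
pose F := filter_from setT (fun n => (u n).1 [::]).
have PF : ProperFilter F.
  apply: filter_from_proper.
    apply: filter_fromT_filter; first by exists 0%N.
    move=> a b; exists (maxn a b) => x ux; split.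
      by apply: dec ux; exact: leq_maxl.
    by apply: dec ux; exact: leq_maxr.
  move=> n _; apply: contrapT => n0; have [_ _ nI _] := gu n; apply: nI.
  by apply: ideal_sub (ideal0 x0 sI) => // x ux; apply: n0; exists x.
have [G [UG FG]] := ultraFilterLemma PF.
have /choice[y yP] n : exists y, (G --> y) /\ (u n).1 [::] y.
  have [[_ cv] _ _ _] := gu n.
  have [|y [Gy uy]] := cv G (sg^~ n) UG; last by exists y; split=> //;
    exact: (uy 0%N).
  move=> m; apply: filterS (sub m n) _; apply: FG.
  by exists (n + m)%N.
exists (y 0%N) => n.
have -> : y 0%N = y n; last exact: (yP n).2.
exact: (cvg_unique KX.1.1 (yP 0%N).1 (yP n).1).
Qed.

(* Codes a subset of the Cantor space by one of its points: the union of the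
   branches of the tree of cylinders [s |-> cyl (tree_decode c s)]. *)
Let tree_decode (c : nat -> bool) (s : seq bool) : seq bool :=
  xget [::] [set w | c (pickle (s, w)) = true].

Let tree_body (c : nat -> bool) : set (nat -> bool) :=
  [set r | exists a, forall n, cyl (tree_decode c (mkseq a n)) r].

(** Iterated splitting builds a binary tree of nodes inside [B]. Each branch [a] has a limit [y a]
    in [B], and [c] records the cylinders; their lengths grow, so a point in all cylinders along [a]
    equals [q (y a)]. *)
Lemma perfect_image (B : set X) : KAnalytic_set B -> B `<=` P -> ~ I B ->
  exists c, tree_body c `<=` q @` B /\
    exists2 f : (nat -> bool) -> (nat -> bool),
      injective f & forall a, tree_body c (f a).
Proof.
move=> KB BP nB; have [D [sD D0 KD]] := KAnalytic_scheme KX KB.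
have groot : good (D, [::]) by split=> //=; rewrite D0 // => x /BP.
have /choice[ch chP] (u : {u | good u}) : exists v : bool -> {u | good u},
    [/\ forall b, refines (sval u) (sval (v b)),
     forall b, (size (sval u).2 < size (sval (v b)).2)%N,
     (sval (v false)).2 != (sval (v true)).2 &
     size (sval (v false)).2 = size (sval (v true)).2].
  have [[v0 v1] /= [g0 g1 r0 r1 [ne sz lt]]] := node_split (svalP u).
  exists (fun b => if b then exist _ v1 g1 else exist _ v0 g0).
  by split=> // -[] //=; rewrite -sz.
pose st s := foldl ch (exist _ _ groot) s.
have stS a n : st (mkseq a n.+1) = ch (st (mkseq a n)) (a n).
  by rewrite mkseqS /st foldl_rcons.
pose c n := if unpickle n is Some (s, w) then (sval (st s)).2 == w else false.
have cE s : tree_decode c s = (sval (st s)).2.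
  have : [set w | c (pickle (s, w)) = true] (tree_decode c s).
    apply: xgetPex; exists (sval (st s)).2.
    by rewrite /= /c pickleK eqxx.
  by rewrite /= /c pickleK => /eqP.
have szst a n : (n <= size (sval (st (mkseq a n))).2)%N.
  elim: n => // n IH; apply: leq_ltn_trans IH _.
  by rewrite stS; have [_ + _ _] := chP (st (mkseq a n)).
have /choice[y yP] a : exists y, forall n, (sval (st (mkseq a n))).1 [::] y.
  apply: (@node_limit (fun n => sval (st (mkseq a n)))) => n;
    first exact: svalP.
  by rewrite stS; have [+ _ _ _] := chP (st (mkseq a n)).
have ycyl a n : cyl (sval (st (mkseq a n))).2 (q (y a)).
  by have [_ _ _ h] := svalP (st (mkseq a n)); have [_ ] := h _ (yP a n).
exists c; split.
  move=> r [a ar]; exists (y a); first by rewrite -D0; exact: (yP a 0%N).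
  apply/funext => n; have := ar n.+1; rewrite cE => rn.
  have := ycyl a n.+1; rewrite /cyl /= in rn *; rewrite -[RHS]rn.
  move=> /(congr1 (fun s => nth false s n)).
  by rewrite !nth_mkseq //; exact: szst.
exists (fun a => q (y a)); last by move=> a; exists a => n; rewrite cE;
  exact: ycyl.
move=> a b e; apply: contrapT => ab.
have [n nab] : exists n, a n != b n.
  apply: contrapT => n; apply: ab; apply/funext => i.
  by apply/eqP; apply: contrapT => /negP ni; apply: n; exists i.
(* At the first difference of [a] and [b], the two children of the common node carry distinct words
   of equal length, whose cylinders are disjoint. *)
have {n nab} [n nab eqn] := ex_minnP (ex_intro (fun n => a n != b n) n nab).
have pre : mkseq a n = mkseq b n.
  apply: (@eq_from_nth _ false); rewrite !size_mkseq // => i ni.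
  rewrite !nth_mkseq //; apply/eqP; apply: contraLR ni => /eqn.
  by rewrite -leqNgt.
have [_ _ /eqP ne sz] := chP (st (mkseq a n)).
have ya := ycyl a n.+1; have yb := ycyl b n.+1.
rewrite stS in ya; rewrite stS -pre -e in yb.
rewrite /cyl /= in ya yb; apply: ne.
by move: nab ya yb; case: (a n); case: (b n) => // _; rewrite sz => -> ->.
Qed.

Theorem four_poles : I P.
Proof.
apply: contrapT => nP.
pose inj_in (A : set (nat -> bool)) := exists2 f :
  (nat -> bool) -> (nat -> bool),
  injective f & forall a, A (f a).
(* Bodies without a copy of the Cantor space are replaced by the whole space, so that every [F c]
   satisfies the hypothesis of [bernstein]. *)
pose F c := [set r | inj_in (tree_body c) -> tree_body c r].
have [|S SP] := @bernstein F.
  move=> c; have [[f fi ft]|nc] := pselect (inj_in (tree_body c)).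
    by exists f => // a _; exact: ft.
  by exists id => // a /nc.
have [S' [nS' hS']] : exists S', ~ I (P `&` q @^-1` S') /\ forall c, ~ F c `<=`
  S'.
  have [IS|nS] := pselect (I (P `&` q @^-1` S)).
    exists (~` S); split; last by move=> c; have [] := SP c.
    move=> IS'; apply: nP; apply: ideal_sub (idealU x0 sI IS IS') => // x Px.
    by have [Sx|Sx] := pselect (S (q x)); [left|right].
  by exists S; split=> // c; have [] := SP c.
have [|B [KB [BS nB]]] := qsemi (S := S') KX.2; first by rewrite setTI.
have [|c [cB cinj]] := perfect_image KB _ nB; first by move=> x /BS[_ []].
apply: (hS' c) => r /(_ cinj) /cB[x /BS[_ [_ Sx]] <-].
exact: Sx.
Qed.
End FourPoles.

(** * Topological groups *)

Lemma KAnalytic_lindelof (X : topologicalType) :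
  KAnalytic_space X -> lindelof X.
Proof.
case=> _ [Z [f [LZ [_ [cf fT]]]]] C oC covC.
have [||D [DC [cD covD]]] := LZ [set f @^-1` U | U in C].
- by move=> _ [U CU <-]; apply: open_comp; [move=> ? _; exact: cf|exact: oC].
- apply/seteqP; split=> // z _; have : [set: X] (f z) by [].
  by rewrite -covC => -[U CU Uz]; exists (f @^-1` U) => //; exists U.
exists [set f @` V | V in D]; split; first last.
  split; first exact: card_le_trans (card_image_le _ _) cD.
  apply/seteqP; split=> // x _; have [z _ <-] : range f x by rewrite fT.
  have : [set: Z] z by []; rewrite -covD => -[V DV Vz].
  by exists (f @` V); [exists V|exists z].
move=> _ [V DV <-]; have [U CU <-] := DC _ DV.
by rewrite image_preimage.
Qed.

Definition countably_separated (X : Type) (R : X -> X -> Prop) :=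
  exists G : nat -> set X, forall x y, (forall n, G n x <-> G n y) -> R x y.

Lemma countably_separated_forall (X : Type) (R : nat -> X -> X -> Prop) :
  (forall n, countably_separated (R n)) ->
  countably_separated (fun x y => forall n, R n x y).
Proof.
move=> /choice[G GP].
exists (fun m => if unpickle m is Some (i, j) then G i j else set0).
move=> x y xy n; apply: GP => i.
by have := xy (pickle (n, i)); rewrite pickleK.
Qed.

Section TopologicalGroup.
Context (X : topologicalType) (mul : X -> X -> X) (inv : X -> X) (one : X).
Hypothesis tg : topological_group mul inv one.
Local Infix "**" := mul (at level 40, left associativity).

Let mulA := tg_mulA tg.
Let mul1 := tg_mul1x tg.
Let mul1r := tg_mulx1 tg.

Lemma tgKV x y : x ** (inv x ** y) = y.
Proof. by rewrite mulA (tg_mulxV tg) mul1. Qed.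

Lemma tgK x y : inv x ** (x ** y) = y.
Proof. by rewrite mulA (tg_mulVx tg) mul1. Qed.

Lemma tg_inv_eq x y : x ** y = one -> inv x = y.
Proof. by move=> xy; rewrite -(tgK x y) xy mul1r. Qed.

Lemma tg_invM x y : inv (x ** y) = inv y ** inv x.
Proof.
by apply: tg_inv_eq; rewrite -mulA (mulA y) (tg_mulxV tg) mul1 (tg_mulxV tg).
Qed.

Lemma tg_invK x : inv (inv x) = x.
Proof. by apply: tg_inv_eq; exact: (tg_mulVx tg). Qed.

Lemma tg_inv1 : inv one = one.
Proof. by apply: tg_inv_eq; rewrite mul1. Qed.

Lemma nbhs_tg_mul a b (N : set X) : nbhs (a ** b) N ->
  exists U V, [/\ nbhs a U, nbhs b V & forall u v, U u -> V v -> N (u ** v)].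
Proof.
move=> nN; have /= [[U V] /= [nU nV] UV] := tg_mul_cont tg (x := (a, b)) nN.
by exists U, V; split=> // u v Uu Vv; apply: (UV (u, v)).
Qed.

Lemma nbhs_tg_translate a b (N : set X) : nbhs (a ** b) N ->
  nbhs b [set x | N (a ** x)].
Proof.
move=> /nbhs_tg_mul[U [V [/nbhs_singleton Ua nV UV]]].
by apply: filterS nV => v; exact: UV.
Qed.

Lemma nbhs_tg_one x (U : set X) : nbhs one U -> nbhs x [set y | U (inv x ** y)].
Proof. by move=> nU; apply: nbhs_tg_translate; rewrite (tg_mulVx tg). Qed.

Lemma nbhs_tg_halve (N : set X) : nbhs one N -> exists M : set X,
  [/\ open M, M one, forall x, M x -> M (inv x) &
    forall x y, M x -> M y -> N (x ** y)].
Proof.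
rewrite -{1}(mul1 one) => /nbhs_tg_mul[U [V [nU nV UV]]].
pose M0 := (U `&` V)°; pose M := M0 `&` inv @^-1` M0.
have oM0 : open M0 by exact: open_interior.
have M01 : M0 one by apply: filterI.
exists M; split.
- apply: openI => //; apply: open_comp => // x _; exact: (tg_inv_cont tg).
- by split; rewrite //= tg_inv1.
- by move=> x [Mx Mix]; split; rewrite //= tg_invK.
- move=> x y [/interior_subset[Ux _] _] [/interior_subset[_ Vy] _]; exact: UV.
Qed.

Hypothesis LX : lindelof X.

(** Countably many left translates of [U] cover the group. If [x] and [y] lie in the same ones, left
    division by the center of one containing [x] gives [u] and [v]. *)
Lemma countably_separated_nbhs (U : set X) : nbhs one U ->
  countably_separated
    (fun x y => exists u v, [/\ U u, U v & inv x ** y = inv u ** v]).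
Proof.
move=> nU; have [s sP] := lindelof_seq one LX (fun x => nbhs_tg_one x nU).
exists (fun n => [set y | U (inv (s n) ** y)]) => x y xy.
have [n Ux] := sP x; have Uy := (xy n).1 Ux.
exists (inv (s n) ** x), (inv (s n) ** y); split=> //.
by rewrite tg_invM tg_invK -mulA tgKV.
Qed.

(** One error bound is treated at a time. By the Lindelöf property each [z] is [w ** s k] with [w]
    in [U (s k)] for some [k]. If [inv x ** y] is a quotient of two points of [U (s k)], then [f z]
    and [f (inv x ** y ** z)] are both within half the bound of [f (s k)]. *)
Lemma countably_separated_continuous (f : X -> Rdefinitions.R) : continuous f ->
  countably_separated (fun x y => forall z, f (inv x ** y ** z) = f z).
Proof.
move=> cf.
suff /countably_separated_forall[G GP] (n : nat) :
  countably_separated (fun x y =>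
    forall z, ball (f z) n.+1%:R^-1 (f (inv x ** y ** z))).
  exists G => x y /GP xy z; apply/esym/(@Rhausdorff Rdefinitions.R).
  suff : close (f z) (f (inv x ** y ** z)) by rewrite closeEnbhs.
  rewrite ball_close => e.
  have [n ne] : exists n, (n.+1%:R^-1 < e%:num :> Rdefinitions.R)%R.
    by have [n _ /(_ n (leqnn n))] := near_infty_natSinv_lt e; exists n.
  by apply: le_ball (ltW ne) _ _; exact: xy.
set e := (n.+1%:R^-1)%R.
have e0 : (0 < e / 2)%R by rewrite divr_gt0 // invr_gt0 ltr0n.
have /choice[U UP] z : exists U, nbhs one U /\ forall u v w, U u -> U v -> U w
  ->
    ball (f z) (e / 2)%R (f (inv u ** v ** (w ** z))).
  have nN : nbhs (inv one ** one ** (one ** z)) [set y | ball (f z) (e / 2)%R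
    (f y)].
    by rewrite tg_inv1 !mul1; apply: cf; exact: nbhsx_ballx.
  have [A [B [/nbhs_tg_mul[A1 [A2 [nA1 nA2 AA]]] nB AB]]] := nbhs_tg_mul nN.
  exists ((inv @^-1` A1 `&` A2) `&` [set w | B (w ** z)]); split.
    apply: filterI; first by apply: filterI => //; exact: (tg_inv_cont tg).
    have [B1 [B2 [nB1 /nbhs_singleton B2z BB]]] := nbhs_tg_mul nB.
    by apply: filterS nB1 => w Bw; exact: BB.
  by move=> u v w [[Au _] _] [[_ Av] _] [_ Bw]; apply: AB => //; exact: AA.
have nUz z : nbhs z [set y | U z (y ** inv z)].
  have : nbhs (z ** inv z) (U z) by rewrite (tg_mulxV tg); exact: (UP z).1.
  move=> /nbhs_tg_mul[A [B [nA /nbhs_singleton Bz AB]]].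
  by apply: filterS nA => a Aa; exact: AB.
have [s sP] := lindelof_seq one LX nUz.
have /countably_separated_forall[G GP] k := countably_separated_nbhs (UP (s
  k)).1.
exists G => x y /GP xy z; have [k Uk] := sP z.
have [u [v [Uu Uv ->]]] := xy k.
have zE : z = z ** inv (s k) ** s k by rewrite -mulA (tg_mulVx tg) mul1r.
have U1 : U (s k) one by exact: nbhs_singleton (UP (s k)).1.
apply: (@ball_splitr _ _ (f (s k))).
  have := (UP (s k)).2 one one _ U1 U1 Uk.
  by rewrite tg_inv1 !mul1 -zE.
by have := (UP (s k)).2 u v _ Uu Uv Uk; rewrite -zE.
Qed.

Lemma countably_separated_Romega (g : X -> Romega) : continuous g ->
  countably_separated (fun x y => forall z, g (inv x ** y ** z) = g z).
Proof.
move=> cg.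
have /countably_separated_forall[G GP] (i : nat) : countably_separated
    (fun x y => forall z, g (inv x ** y ** z) i = g z i).
  apply: (@countably_separated_continuous (fun x => g x i)) => x.
  apply: (@continuous_comp _ _ _ g (fun h : Romega => h i)); first exact: cg.
  exact: (@proj_continuous nat (fun=> Rdefinitions.R) i).
exists G => x y /GP xy z; apply/funext => i; exact: xy.
Qed.
End TopologicalGroup.

(** * Homomorphisms *)

Lemma well_founded_least (T : Type) (lt : T -> T -> Prop) (A : set T) :
  well_founded lt -> A !=set0 -> exists2 x, A x & forall y, lt y x -> ~ A y.
Proof.
move=> wf [a Aa]; apply: contrapT => n.
suff h x : ~ A x by exact: (h a).
elim/(well_founded_ind wf): x => x IH Ax; apply: n.
by exists x => // y /IH.
Qed.

Section Homomorphism.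
Context (X : topologicalType) (mulX : X -> X -> X) (invX : X -> X) (oneX : X)
  (Y : topologicalType) (mulY : Y -> Y -> Y) (invY : Y -> Y) (oneY : Y)
  (I : set (set X)) (h : X -> Y).
Hypothesis tgX : topological_group mulX invX oneX.
Hypothesis tgY : topological_group mulY invY oneY.
Hypothesis KX : KAnalytic_space X.
Hypothesis sI : sigma_ideal I.
Hypothesis lI : left_invariant mulX I.
Hypothesis fI : fcoanalytic_base I.
Hypothesis hM : forall x y, h (mulX x y) = mulY (h x) (h y).

Lemma tg_hom1 : h oneX = oneY.
Proof.
have := hM oneX oneX; rewrite (tg_mul1x tgX) => e.
by rewrite -[LHS](tgK tgY (h oneX)) -e (tg_mulVx tgY).
Qed.

Lemma tg_homV x : h (invX x) = invY (h x).
Proof. by apply/esym/(tg_inv_eq tgY); rewrite -hM (tg_mulxV tgX) tg_hom1. Qed.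

Hypothesis hsemi : semimeasurable_fun I h.

(** The product in the group of [S] and the preimage of [W] under [h]. *)
Let thick (S : set X) (W : set Y) : set X :=
  [set z | exists2 y, S y & W (h (mulX (invX y) z))].

Lemma thick_semimeasurable (S : set X) (W : set Y) : open W ->
  semimeasurable_set I (thick S W).
Proof.
move=> oW.
suff -> : thick S W = h @^-1` (\bigcup_(s in S) [set y | W (mulY (invY (h s))
  y)]).
  apply: hsemi; apply: bigcup_open => s _; rewrite openE => y Wy.
  by apply: (nbhs_tg_translate tgY); exact: open_nbhs_nbhs.
by apply/seteqP; split=> z [y Sy Wy]; exists y => //;
  rewrite /= -tg_homV -hM in Wy *.
Qed.

(* The sets [thick (core x k) (W k.+1)] are Stone's sigma-discrete refinement of
   the cover of [X] by the left translates of [Vs]. Those whose centers share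
   the code [r x] lie in one translate of a fixed negligible set, so the index
   set of each discrete layer can be taken in the Cantor space. *)
Theorem hom_preimage_notin_ideal (W0 : set Y) :
  nbhs oneY W0 -> ~ I (h @^-1` W0).
Proof.
move=> nW0 IW0.
have /choice[M MP] N : exists M : set Y, nbhs oneY N -> [/\ open M, M oneY,
    forall x, M x -> M (invY x) & forall x y, M x -> M y -> N (mulY x y)].
  have [nN|nN] := pselect (nbhs oneY N); last by exists setT.
  by have [M ?] := nbhs_tg_halve tgY nN; exists M.
(* Symmetric open neighborhoods, the product of two copies of [W k.+1] lying in [W k]. *)
pose W := fix W k := if k is k'.+1 then M (W k') else M W0.
have nW k : nbhs oneY (W k).
  by elim: k => [|k IH] /=; [have [] := MP _ nW0|have [] := MP _ IH] => *;
    exact: open_nbhs_nbhs.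
have oW k : open (W k) by case: k => [|k]; [have [] := MP _ nW0|have [] :=
  MP _ (nW k)].
have W1 k : W k oneY by exact: nbhs_singleton.
have WV k y : W k y -> W k (invY y).
  by case: k => [|k]; [have [_ _ + _] := MP _ nW0|have [_ _ + _] :=
    MP _ (nW k)]; exact.
have WM k x y : W k.+1 x -> W k.+1 y -> W k (mulY x y).
  by have [_ _ _] := MP _ (nW k); exact.
have WS k y : W k.+1 y -> W k y.
  by move=> Wy; rewrite -(tg_mulx1 tgY y); exact: WM.
pose V k := h @^-1` W k.
have V1 k : V k oneX by rewrite /V /= tg_hom1.
have IV : I (V 0%N).
  apply: ideal_sub IW0 => // x /= Vx; rewrite -(tg_mulx1 tgY (h x)).
  by have [_ M1 _] := MP _ nW0; apply.
(* [Vs] is the interior of [V 0] in the left-invariant topology for which the [V k] are a base of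
   neighborhoods of the identity. *)
pose Vs := [set v | exists k, forall w, V k w -> V 0%N (mulX v w)].
have VsV : Vs `<=` V 0%N by move=> v [k /(_ _ (V1 k))]; rewrite (tg_mulx1 tgX).
have Vs1 : Vs oneX by exists 0%N => w; rewrite (tg_mul1x tgX).
have VsO v : Vs v -> exists k, forall w, V k w -> Vs (mulX v w).
  move=> [k kP]; exists k.+1 => w Vw; exists k.+1 => w' Vw'.
  by rewrite -(tg_mulA tgX); apply: kP; rewrite /V /= hM; exact: WM.
have [C [IC [VsC [g [B [cg [aB CB]]]]]]] := fI (ideal_sub sI VsV IV).
have [G GP] := countably_separated_Romega tgX (KAnalytic_lindelof KX) cg.
(* [r x] is the code of [x]. For [x] and [y] with equal codes, left multiplication by
   [mulX (invX x) y] preserves [g], hence [C]. *)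
pose r x n := `[< G n x >].
have rP x y z : r x = r y -> C z -> C (mulX (mulX (invX x) y) z).
  move=> rxy Cz; have gxy : g (mulX (mulX (invX x) y) z) = g z.
    apply: GP => n; have := congr1 (fun f => f n) rxy; rewrite /r => e.
    by split=> /asboolP; [rewrite e|rewrite -e] => /asboolP.
  apply: contrapT => nC; have : (~` C) (mulX (mulX (invX x) y) z) by [].
  by rewrite CB /= gxy -[B _]/((g @^-1` B) z) -CB; apply.
have [lt [wf tri _]] := initial_order X.
(* The points lying in the translate of [Vs] by [x] with margin [V k], and in no translate by an
   earlier [x']. *)
pose core x k := [set y | (forall w, V k w -> Vs (mulX (invX x) (mulX y w))) /\
  forall x', lt x' x -> ~ Vs (mulX (invX x') y)].
pose E x k := thick (core x k) (W k.+1).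
have EVs x k z : E x k z -> Vs (mulX (invX x) z).
  move=> [y [yP _] Wy]; rewrite -(tgKV tgX y z); apply: yP; exact: WS.
(* [w] moves the core point [y'] of [x'] to the core point [y] of [x] within the margin [V k]. So
   [y] lies in the translate by the earlier [x'], which its core forbids. *)
have Elt k x x' z : lt x' x -> E x k z -> ~ E x' k z.
  move=> xx [y [_ yP] Wy] [y' [y'P _] Wy']; apply: (yP _ xx).
  pose w := mulX (mulX (invX y') z) (invX (mulX (invX y) z)).
  suff -> : y = mulX y' w by apply: y'P; rewrite /V /= hM tg_homV;
    apply: WM => //; exact: WV.
  by rewrite /w (tg_invM tgX) (tg_invK tgX) !(tg_mulA tgX) (tg_mulxV tgX)
    (tg_mul1x tgX) (tg_mulxV tgX) (tg_mul1x tgX).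
have Euniq k x x' z : E x k z -> E x' k z -> x = x'.
  move=> Ex Ex'; have [xx|//|xx] := tri x x'; first by have :=
    Elt _ _ _ _ xx Ex' Ex.
  by have := Elt _ _ _ _ xx Ex Ex'.
have Ecov y : exists k x, E x k y.
  have [|x Vx xP] := @well_founded_least _ _ [set x | Vs (mulX (invX x) y)] wf.
    by exists y; rewrite /= (tg_mulVx tgX).
  have [k kP] := VsO _ Vx; exists k, x, y; last by rewrite (tg_mulVx tgX);
    exact: (V1 k.+1).
  by split=> // w Vw; rewrite (tg_mulA tgX); exact: kP.
pose P k := \bigcup_x E x k.
have [_ [_ [_ nIT]]] := sI; apply: nIT.
apply: (@ideal_sub _ _ sI _ (\bigcup_k P k)).
  by move=> y _; have [k [x Exy]] := Ecov y; exists k => //; exists x.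
apply: (ideal_bigcup oneX sI) => k.
(* The code of the unique [x] with [E x k z]; outside the layer [P k] the default [oneX] is
   coded. *)
pose q z := r (xget oneX [set x | E x k z]).
have qE x z : E x k z -> q z = r x.
  move=> Exz; congr r; apply: (Euniq k _ _ z) => //.
  by apply: (@xgetPex _ oneX [set x | E x k z]); exists x.
apply: (@four_poles X oneX I q) => // [S|r0].
  rewrite (_ : _ `&` _ = thick [set y | exists2 x, S (r x) & core x k y] (W
    k.+1)).
    exact: thick_semimeasurable.
  apply/seteqP; split=> z.
    move=> [[x _ Ex] Sq]; move: Sq (Ex); rewrite /= (qE _ _ Ex) => Sx [y cy Wy].
    by exists y => //; exists x.
  move=> [y [x Sx cy] Wy]; have Ex : E x k z by exists y.
  by split; [exists x|rewrite /= (qE _ _ Ex)].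
have [[x0 rx0]|nr] := pselect (exists x, r x = r0); last first.
  by apply: ideal_sub (ideal0 oneX sI) => // z [_ /= qz]; apply: nr; eexists;
    exact: qz.
(* Over the single code [r x0], the layer lies in the left translate of [C] by [x0]. *)
apply: ideal_sub (lI x0 IC) => // z [[x _ Ex] /=]; rewrite (qE _ _ Ex) => rx.
exists (mulX (invX x0) z); last by rewrite (tgKV tgX).
have -> : mulX (invX x0) z = mulX (mulX (invX x0) x) (mulX (invX x) z).
  by rewrite -(tg_mulA tgX) (tgKV tgX).
by apply: rP; [rewrite rx0 rx|exact: VsC (EVs _ _ _ Ex)].
Qed.

End Homomorphism.

(** * From measurability to semimeasurability *)

Lemma gen_pm_sigma_algebra (X : topologicalType) (A I : set (set X)) :
  sigma_algebra setT (gen_pm A I).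
Proof. exact: smallest_sigma_algebra. Qed.

Lemma gen_pm_sub (X : topologicalType) (A I : set (set X)) :
  A `|` I `<=` gen_pm A I.
Proof. exact: sub_gen_smallest. Qed.

(** The sets equal modulo [I] to some [F] that is Souslin with its complement form a sigma-algebra
    containing [Ba X] and [I]. A functionally coanalytic [C] in [I] covers the difference of [M] and
    [F]; then [A] meets [F] outside [C] in a K-analytic subset of [M]. *)
Lemma gen_pm_Ba_semimeasurable (X : topologicalType) (x0 : X) (I : set (set X))
    (M : set X) : KAnalytic_space X -> sigma_ideal I -> fcoanalytic_base I ->
  gen_pm (Ba X) I M -> semimeasurable_set I M.
Proof.
move=> KX sI fI MI.
pose approx (M F : set X) := [/\ souslin F, souslin (~` F) &
  I ((M `\` F) `|` (F `\` M))].
have [F [sF sCF IF]] : exists F, approx M F.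
  suff : [set M | exists F, approx M F] M by [].
  apply: MI; split; first split.
  - exists set0; split; first by apply: souslin_closed; exact: closed0.
      by rewrite setC0; apply: souslin_closed; exact: closedT.
    by rewrite setDv setU0; exact: (ideal0 x0).
  - move=> N [F [sF sCF IF]]; exists (~` F); split=> //; first by rewrite setCK.
    apply: ideal_sub IF => // x [[[_ nN] /contrapT Fx]|[nF nN]];
      [by right|left].
    by split=> //; apply: contrapT => nNx; apply: nN.
  - move=> N /choice[F FP]; exists (\bigcup_n F n); split.
    + by apply: souslin_bigcup => n; have [] := FP n.
    + by rewrite setC_bigcup; apply: souslin_bigcap => n; have [] := FP n.
    + have IFn n : I ((N n `\` F n) `|` (F n `\` N n)) by have [] := FP n.
      apply: ideal_sub (ideal_bigcup x0 sI IFn) => //.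
      move=> x [[[n _ Nx] nF]|[[n _ Fx] nN]]; exists n => //.
        by left; split=> // Fx; apply: nF; exists n.
      by right; split=> // Nx; apply: nN; exists n.
  - move=> N [/fBorel_souslin[sN sCN]|IN].
      by exists N; split=> //; rewrite !setDv setU0; exact: (ideal0 x0).
    exists set0; split; first by apply: souslin_closed; exact: closed0.
      by rewrite setC0; apply: souslin_closed; exact: closedT.
    by rewrite setD0 set0D setU0.
have [C [IC [sC /fanalytic_souslin sCC]]] := fI _ IF.
move=> A KA nA; exists (A `&` (F `&` ~` C)); split.
  apply: souslin_KAnalytic => //.
  apply: souslinI; last exact: souslinI.
  by apply: KAnalytic_souslin => //; exact: KX.1.1.
split.
  move=> x [Ax [Fx nCx]]; split=> //; apply: contrapT => nMx; apply: nCx.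
  by apply: sC; right.
apply: contra_not nA => IB; apply: (ideal_sub sI _ (idealU x0 sI IB IC)).
move=> x [Ax Mx]; have [Cx|nCx] := pselect (C x); first by right.
left; split=> //; split=> //; apply: contrapT => nFx; apply: nCx.
by apply: sC; left.
Qed.

(** * The equivalence of the four conditions *)

Lemma setpow_nbhs (Y : topologicalType) (mul : Y -> Y -> Y) (inv : Y -> Y)
    (one : Y) (n : nat) (V : set Y) :
  topological_group mul inv one -> nbhs one V ->
  exists2 P : set Y, nbhs one P & forall S, S `<=` P -> setpow mul S n `<=` V.
Proof.
move=> tg; elim: n V => [|[|n] IH] V nV; [by exists V|by exists V|].
have [M [oM M1 _ MV]] := nbhs_tg_halve tg nV.
have nM : nbhs one M by exact: open_nbhs_nbhs.
have [P nP PM] := IH M nM; exists (P `&` M); first exact: filterI.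
move=> S SPM _ [s Ss [t St <-]]; apply: MV; last by have [] := SPM _ St.
by apply: (PM S) => // x /SPM[].
Qed.

Lemma setpow_hom (X Y : topologicalType) (mulX : X -> X -> X)
    (mulY : Y -> Y -> Y) (h : X -> Y) (S : set X) (S' : set Y) n :
  (forall x y, h (mulX x y) = mulY (h x) (h y)) -> S `<=` h @^-1` S' ->
  setpow mulX S n `<=` h @^-1` setpow mulY S' n.
Proof.
move=> hM SS'; elim: n => [|[|n] IH] //.
move=> _ [s Ss [t St <-]]; rewrite /preimage /= hM.
by exists (h s); [exact: IH|exists (h t); [exact: SS'|]].
Qed.

Theorem theorem5p4
  (X : topologicalType) (mulX : X -> X -> X) (invX : X -> X) (oneX : X)
  (Y : topologicalType) (mulY : Y -> Y -> Y) (invY : Y -> Y) (oneY : Y)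
  (I : set (set X)) (h : X -> Y) :
  topological_group mulX invX oneX ->
  topological_group mulY invY oneY ->
  KAnalytic_space X ->
  sigma_ideal I ->
  left_invariant mulX I ->
  steinhaus mulX invX oneX I ->
  fcoanalytic_base I ->
  Bo X `<=` gen_pm (Ba X) I ->
  (forall x y, h (mulX x y) = mulY (h x) (h y)) ->
  (continuous h <-> measurable_wrt (gen_pm (Bo X) I) h) /\
  (continuous h <-> measurable_wrt (gen_pm (Ba X) I) h) /\
  (continuous h <-> semimeasurable_fun I h).
Proof.
move=> tgX tgY KX sI lI [n [n0 SI]] fI BoI hM.
(* This carries measurability modulo [I] from [Bo] over to [Ba]. *)
have BoBa : gen_pm (Bo X) I `<=` gen_pm (Ba X) I.
  apply: smallest_sub; first exact: gen_pm_sigma_algebra.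
  move=> A [/BoI //|IA]; apply: gen_pm_sub; by right.
have cont_Bo : continuous h -> measurable_wrt (gen_pm (Bo X) I) h.
  move=> ch U oU; apply: gen_pm_sub; left; apply: sub_gen_smallest.
  suff : open (h @^-1` U) by [].
  by apply: open_comp => // x _; exact: ch.
have Ba_semi : measurable_wrt (gen_pm (Ba X) I) h -> semimeasurable_fun I h.
  by move=> mh U oU; apply: (gen_pm_Ba_semimeasurable oneX) => //; exact: mh.
have semi_cont : semimeasurable_fun I h -> continuous h.
  move=> sh x N nN.
  have nV : nbhs oneY [set y | N (mulY (h x) y)].
    by apply: (nbhs_tg_translate tgY); rewrite (tg_mulx1 tgY).
  (* [W] is taken so small that the [n]-fold power of its quotient set lies in the translate of [N]
     by the inverse of [h x]. The Steinhaus property, for a K-analytic [B] in the preimage of [W],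
     then yields a neighborhood of [x]. *)
  have [P nP PV] := setpow_nbhs n tgY nV.
  have [W [oW W1 WV WP]] := nbhs_tg_halve tgY nP.
  have nW : ~ I (h @^-1` W).
    apply: (hom_preimage_notin_ideal tgX tgY KX sI lI fI hM sh).
    exact: open_nbhs_nbhs.
  have [|B [KB [BW nB]]] := sh W oW _ KX.2; first by rewrite setTI.
  have := nbhs_tg_one tgX x (SI B KB nB); apply: filterS => y By.
  rewrite /= -(tgKV tgX x y) hM.
  apply: (PV (setdiff_inv mulY invY W)).
    by move=> _ [s Ws [_ [t Wt <-] <-]]; apply: WP => //; exact: WV.
  apply: setpow_hom By => // _ [s Bs [_ [t Bt <-] <-]].
  exists (h s); first by have [_] := BW _ Bs.
  exists (invY (h t)); first by exists (h t) => //; have [_] := BW _ Bt.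
  by rewrite hM (tg_homV tgX tgY hM).
split; [|split]; split.
- exact: cont_Bo.
- by move=> mh; apply/semi_cont/Ba_semi => U oU; apply: BoBa; exact: mh.
- by move=> ch U oU; apply: BoBa; exact: cont_Bo.
- by move=> /Ba_semi/semi_cont.
- by move=> ch; apply: Ba_semi => U oU; apply: BoBa; exact: cont_Bo.
- exact: semi_cont.
Qed.
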